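(* Let $1\le p\neq q<\infty$. Every normalized unconditional basis of the space $(\bigoplus_{n=1}^\infty\ell_p)_{\ell_q}$ has a subsequence equivalent to the unit vector basis of $\ell_p$ and another subsequence equivalent to the unit vector basis of $\ell_q$. Similarly, for $1\le p<\infty$, every normalized unconditional basis of $(\bigoplus_{n=1}^\infty\ell_p)_{c_0}$ has a subsequence equivalent to the unit vector basis of $\ell_p$ and another subsequence equivalent to the unit vector basis of $c_0$; and for $1\le q<\infty$, every normalized unconditional basis of $(\bigoplus_{n=1}^\infty c_0)_{\ell_q}$ has a subsequence equivalent to the unit vector basis of $c_0$ and another subsequence equivalent to the unit vector basis of $\ell_q$. Consequently, none of the spaces $(\bigoplus_{n=1}^\infty\ell_p)_{\ell_q}$ ($1\le p\neq q<\infty$), $(\bigoplus_{n=1}^\infty\ell_p)_{c_0}$ ($1\le p<\infty$), $(\bigoplus_{n=1}^\infty c_0)_{\ell_q}$ ($1\le q<\infty$) has a greedy basis.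
   Context: For a sequence of Banach spaces $X_n$, $(\bigoplus_{n=1}^\infty X_n)_{\ell_q}$ is the space of sequences $(x_n)$, $x_n\in X_n$, with $\|(x_n)\|=(\sum_n\|x_n\|^q)^{1/q}<\infty$, and $(\bigoplus_{n=1}^\infty X_n)_{c_0}$ is the space of sequences with $\|x_n\|\to0$ under the sup norm. Equivalently these are spaces of real matrices $a=(a(i,j))$ with norm $(\sum_j(\sum_i|a(i,j)|^p)^{q/p})^{1/q}$, with $\ell_\infty$-norms (and closure of finitely supported matrices, i.e. $c_0$) replacing $\ell_p$ or $\ell_q$ when the index is $\infty$. A Schauder basis $\{x_i\}$ of a Banach space $X$ is unconditional if there is $C<\infty$ with $\|\sum \varepsilon_i a_i x_i\|\le C\|\sum a_ix_i\|$ for all finitely supported scalars $(a_i)$ and signs $\varepsilon_i=\pm1$. It is democratic if there is $C<\infty$ with $\|\sum_{i\in A}x_i\|\le C\|\sum_{i\in B}x_i\|$ for all finite $A,B\subset\mathbb{N}$ with $|A|=|B|$. It is greedy if there is $C<\infty$ such that for every $x=\sum a_ix_i\in X$, every $n\in\mathbb{N}$ and every $A\subset\mathbb{N}$ with $|A|=n$ and $\min_{i\in A}|a_i|\ge\sup_{i\notin A}|a_i|$, one has $\|x-\sum_{i\in A}a_ix_i\|\le C\inf\{\|x-\sum_{i\in B}b_ix_i\|: |B|=n,\ b_i\in\mathbb{R}\}$. Two sequences $\{u_i\},\{v_i\}$ are equivalent if there are constants $0<c\le C$ with $c\|\sum a_iv_i\|\le\|\sum a_iu_i\|\le C\|\sum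 a_iv_i\|$ for all finitely supported scalars. *)

(* Defs.v *)
From Stdlib Require Import Reals List.
From Coquelicot Require Import Coquelicot.
Open Scope R_scope.

Definition rpw (x p : R) : R := if Rle_dec x 0 then 0 else Rpower x p.

Inductive expo := Fin (p : R) | Czero.

Definition seq_mem (e : expo) (f : nat -> R) : Prop :=
  match e with
  | Fin p => ex_series (fun i => rpw (Rabs (f i)) p)
  | Czero => is_lim_seq f 0
  end.

Definition seq_norm (e : expo) (f : nat -> R) : R :=
  match e with
  | Fin p => rpw (Series (fun i => rpw (Rabs (f i)) p)) (1 / p)
  | Czero => real (Sup_seq (fun i => Rabs (f i)))
  end.

(** Real matrices a(i,j): i = index inside the block, j = block index. *)
Definition mat := nat -> nat -> R.

Definition mix_mem (e f : expo) (a : mat) : Prop :=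
  (forall j, seq_mem e (fun i => a i j)) /\
  seq_mem f (fun j => seq_norm e (fun i => a i j)).

Definition mix_norm (e f : expo) (a : mat) : R :=
  seq_norm f (fun j => seq_norm e (fun i => a i j)).

Fixpoint fsum (N : nat) (f : nat -> R) : R :=
  match N with O => 0 | S n => fsum n f + f n end.

Definition lcomb (N : nat) (a : nat -> R) (x : nat -> mat) : mat :=
  fun i j => fsum N (fun k => a k * x k i j).

Definition lcomb_list (A : list nat) (a : nat -> R) (x : nat -> mat) : mat :=
  fun i j => fold_right (fun k s => a k * x k i j + s) 0 A.

Definition msub (y z : mat) : mat := fun i j => y i j - z i j.

Section Bases.
Variables (X : mat -> Prop) (nrm : mat -> R).

Definition expands (x : nat -> mat) (y : mat) (a : nat -> R) : Prop :=
  is_lim_seq (fun N => nrm (msub y (lcomb N a x))) 0.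

Definition schauder_basis (x : nat -> mat) : Prop :=
  (forall n, X (x n)) /\
  forall y, X y -> exists a, expands x y a /\
    forall b, expands x y b -> forall n, b n = a n.

Definition unconditional (x : nat -> mat) : Prop :=
  exists C, forall (N : nat) (a eps : nat -> R),
    (forall k, eps k = 1 \/ eps k = -1) ->
    nrm (lcomb N (fun k => eps k * a k) x) <= C * nrm (lcomb N a x).

Definition normalized (x : nat -> mat) : Prop := forall n, nrm (x n) = 1.

Definition normalized_unconditional_basis (x : nat -> mat) : Prop :=
  schauder_basis x /\ unconditional x /\ normalized x.

Definition trunc (N : nat) (a : nat -> R) : nat -> R :=
  fun k => if Nat.ltb k N then a k else 0.

Definition equiv_unit_basis (u : nat -> mat) (e : expo) : Prop :=
  exists c C, 0 < c <= C /\ forall (N : nat) (a : nat -> R),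
    c * seq_norm e (trunc N a) <= nrm (lcomb N a u) /\
    nrm (lcomb N a u) <= C * seq_norm e (trunc N a).

Definition has_subseq_equiv (x : nat -> mat) (e : expo) : Prop :=
  exists phi : nat -> nat, (forall n, (phi n < phi (S n))%nat) /\
    equiv_unit_basis (fun n => x (phi n)) e.

Definition greedy (x : nat -> mat) : Prop :=
  exists C, forall (y : mat) (a : nat -> R) (n : nat) (A : list nat),
    X y -> expands x y a ->
    NoDup A -> length A = n ->
    (forall i j, In i A -> ~ In j A -> Rabs (a j) <= Rabs (a i)) ->
    forall (B : list nat) (b : nat -> R), NoDup B -> length B = n ->
      nrm (msub y (lcomb_list A a x)) <= C * nrm (msub y (lcomb_list B b x)).

Definition greedy_basis (x : nat -> mat) : Prop := schauder_basis x /\ greedy x.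

End Bases.

(* Main.v *)
Require Import Defs.
From Stdlib Require Import Reals List.
From Coquelicot Require Import Coquelicot.
From Stdlib Require Import Lra Lia FunctionalExtensionality Classical ClassicalEpsilon.
Open Scope R_scope.

(** Let [x_n] be the basis, [x_n^*] its biorthogonal functionals, and for a region [T] of indices
[(i, j)] let [u(T, n) = x_n^*(R_T x_n)], where [R_T] restricts to [T].  Averaging over signs the
composition of unconditional multipliers with respect to [x_n] and to the unit matrices extracts
diagonals of operators, so these numbers alone decide embeddings.  Let [T_t] be a family of regions
shrinking to the empty set in norm: the columns [j >= t], on which disjoint shells
[T_s \ T_t] span the outer space, or the entries [i >= t] of the first [k] columns, on which they
span the inner space.
- If [|u(T_t, n)| >= 1/4] for every [t] and infinitely many [n], a subsequence of [x_n] is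
  equivalent to its restrictions to disjoint shells, hence to the corresponding unit basis.
- If [u(T_t, n) >= 1/4] for every [t] and all large [n], any sequence of unit matrices has a
  subsequence which factors, through blocks of [x_n] with well chosen signs, through disjoint
  shells of [T].
As [u] of the two regions sums to [1] up to finitely many entries (whose contribution vanishes as
[n] grows), failure of the first alternative for one family forces the second one for the other,
and makes the inner and outer unit bases equivalent, which is absurd.  A greedy basis is
unconditional, seminormalized and democratic, so the two subsequences would have sums of [N] terms
of comparable size. *)

(** * Real powers *)

(** The vectors of a normalized unconditional basis need not tend to [0] entrywise: in [ℓ_1] the
    vectors [e_0] and [(e_0 + e_n) / 2], [n >= 1], form such a basis. What does tend to [0] is
    [x_n^*(y)] for each fixed [y]. Hence a single entry contributes less and less to
    [x_n^*(x_n) = 1], however large that entry of [x_n] remains; this is why the diagonal numbers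
    are followed instead of the vectors.

    Nothing is known about the cross terms [x_k^*(R_T x_n)], [k <> n]. They disappear because the
    product of two signs [th a * th b] has mean [1] for [a = b] and [0] otherwise, while
    unconditionality of the basis and of the unit matrices bounds every term of the average.

    The threshold [1/4] is half of [1/2]: the finitely many entries outside both regions account for
    less than [1/2] of the total [1], so the two numbers add up to at least [1/2], and when one is
    below [1/4] the other is above it. *)

Lemma rpw_nonneg (x p : R) : 0 <= rpw x p.
Proof.
unfold rpw; destruct (Rle_dec x 0); [lra|].
left; apply exp_pos.
Qed.

Lemma rpw_pos (x p : R) : 0 < x -> rpw x p = Rpower x p.
Proof. intros H; unfold rpw; destruct (Rle_dec x 0); lra. Qed.

Lemma rpw_0 (p : R) : rpw 0 p = 0.
Proof. unfold rpw; destruct (Rle_dec 0 0); lra. Qed.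

Lemma rpw_1 (p : R) : rpw 1 p = 1.
Proof.
rewrite rpw_pos by lra; unfold Rpower; rewrite ln_1, Rmult_0_r; apply exp_0.
Qed.

Lemma rpw_le (x y p : R) : 0 < p -> x <= y -> rpw x p <= rpw y p.
Proof.
intros Hp Hxy; destruct (Rle_lt_dec x 0) as [Hx|Hx].
- replace (rpw x p) with 0; [apply rpw_nonneg|].
  unfold rpw; destruct (Rle_dec x 0); lra.
- rewrite !rpw_pos by lra; apply Rle_Rpower_l; lra.
Qed.

Lemma rpw_mult (x y p : R) : 0 <= x -> 0 <= y -> rpw (x * y) p = rpw x p * rpw y p.
Proof.
intros [Hx|<-] [Hy|<-]; rewrite ?Rmult_0_l, ?Rmult_0_r, ?rpw_0, ?Rmult_0_l, ?Rmult_0_r; trivial.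
rewrite !rpw_pos by (try apply Rmult_lt_0_compat; lra).
symmetry; apply Rpower_mult_distr; lra.
Qed.

Lemma rpw_rpw (x p q : R) : 0 <= x -> p * q = 1 -> rpw (rpw x p) q = x.
Proof.
intros [Hx|<-] Hpq; [|now rewrite !rpw_0].
rewrite (rpw_pos x) by lra; rewrite rpw_pos by apply exp_pos.
now rewrite Rpower_mult, Hpq, Rpower_1.
Qed.

(** The two tangent inequalities at the point [l * t], evaluated at [t] and at [0], are added with
    weights [l] and [1 - l]; their linear terms cancel. *)
Lemma exp_convex (l t : R) : 0 <= l <= 1 -> exp (l * t) <= l * exp t + (1 - l).
Proof.
intros Hl.
assert (H1 : exp (l * t) * (1 + (1 - l) * t) <= exp t).
{ replace (exp t) with (exp (l * t) * exp ((1 - l) * t)) by (rewrite <- exp_plus; f_equal; ring).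
  apply Rmult_le_compat_l; [left; apply exp_pos|].
  destruct (Req_dec ((1 - l) * t) 0) as [->|H]; [rewrite exp_0; lra|].
  left; now apply exp_ineq1. }
assert (H2 : exp (l * t) * (1 - l * t) <= 1).
{ replace 1 with (exp (l * t) * exp (- (l * t))) at 2
    by (rewrite <- exp_plus, Rplus_opp_r; apply exp_0).
  apply Rmult_le_compat_l; [left; apply exp_pos|].
  destruct (Req_dec (- (l * t)) 0) as [H|H]; [rewrite H, exp_0; lra|].
  assert (G := exp_ineq1 _ H); lra. }
apply (Rmult_le_compat_l l) in H1; [|lra].
apply (Rmult_le_compat_l (1 - l)) in H2; [|lra].
lra.
Qed.

(** This is [exp_convex] with weight [1 / p] at [p * ln r], that is, [r <= r^p / p + 1 - 1 / p]. *)
Lemma rpw_bernoulli (r p : R) : 1 <= p -> 0 <= r -> 1 + p * (r - 1) <= rpw r p.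
Proof.
intros Hp [Hr|<-]; [|rewrite rpw_0; lra].
rewrite rpw_pos by lra.
assert (H := exp_convex (/ p) (p * ln r)).
replace (/ p * (p * ln r)) with (ln r) in H by (field; lra).
rewrite exp_ln in H by lra; fold (Rpower r p) in H.
assert (Hq : 0 <= / p <= 1).
{ split; [left; apply Rinv_0_lt_compat; lra|].
  rewrite <- Rinv_1; apply Rinv_le_contravar; lra. }
specialize (H Hq); apply (Rmult_le_compat_l p) in H; [|lra].
rewrite Rmult_plus_distr_l, Rmult_minus_distr_l, <- Rmult_assoc, Rinv_r in H by lra; lra.
Qed.

(** Bernoulli's inequality at [z / w] is the tangent line of [t^p] at the convex combination [w];
    averaging it over [z = x, y] cancels the slope. The case [w = 0] is separate because of the
    division. *)
Lemma rpw_convex (l x y p : R) : 1 <= p -> 0 <= l <= 1 -> 0 <= x -> 0 <= y ->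
  rpw ((1 - l) * x + l * y) p <= (1 - l) * rpw x p + l * rpw y p.
Proof.
intros Hp Hl Hx Hy.
set (w := (1 - l) * x + l * y).
assert (Hw : 0 <= w) by (unfold w; nra).
destruct Hw as [Hw|Hw].
- assert (key : forall z, 0 <= z -> rpw w p * (1 + p * (z / w - 1)) <= rpw z p).
  { intros z Hz; replace z with (w * (z / w)) at 2 by (field; lra).
    assert (0 <= z / w) by (apply Rdiv_le_0_compat; lra).
    rewrite rpw_mult by lra; apply Rmult_le_compat_l; [apply rpw_nonneg|].
    now apply rpw_bernoulli. }
  assert (Kx := key x Hx); assert (Ky := key y Hy).
  apply (Rmult_le_compat_l (1 - l)) in Kx; [|lra].
  apply (Rmult_le_compat_l l) in Ky; [|lra].
  replace (rpw w p) with ((1 - l) * (rpw w p * (1 + p * (x / w - 1)))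
     + l * (rpw w p * (1 + p * (y / w - 1)))); [lra|].
  transitivity (rpw w p * (1 + p * (((1 - l) * x + l * y) / w - 1))); [field; lra|].
  fold w; field; lra.
- rewrite <- Hw, rpw_0.
  assert (H1 := rpw_nonneg x p); assert (H2 := rpw_nonneg y p); nra.
Qed.

(** * Abstract sequence norms *)

Definition unit_seq (n : nat) : nat -> R := fun i => if Nat.eqb i n then 1 else 0.

(** The common interface of [ℓ_p] and [c_0]. The characteristic property is [ls_disj]: the norm of a
    disjoint sum is controlled by the norms of its parts, which makes disjoint blocks behave like
    unit vectors. [ls_tail] would fail in [ℓ_∞] and provides the shrinking regions. *)
Record lat_seq (mem : (nat -> R) -> Prop) (nr : (nat -> R) -> R) : Prop := {
  ls_lat : forall f g, mem g -> (forall i, Rabs (f i) <= Rabs (g i)) -> mem f /\ nr f <= nr g;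
  ls_add : forall f g, mem f -> mem g ->
    mem (fun i => f i + g i) /\ nr (fun i => f i + g i) <= nr f + nr g;
  ls_scal : forall c f, mem f -> mem (fun i => c * f i) /\ nr (fun i => c * f i) = Rabs c * nr f;
  ls_coord : forall f i, mem f -> Rabs (f i) <= nr f;
  ls_unit : forall n, mem (unit_seq n) /\ nr (unit_seq n) = 1;
  ls_tail : forall f eps, mem f -> 0 < eps ->
    exists t, nr (fun i => if Nat.leb t i then f i else 0) < eps;
  ls_disj : forall f g f' g', mem f -> mem g -> mem f' -> mem g' ->
    (forall i, f i = 0 \/ g i = 0) -> (forall i, f' i = 0 \/ g' i = 0) ->
    nr f <= nr f' -> nr g <= nr g' ->
    nr (fun i => f i + g i) <= nr (fun i => f' i + g' i) }.

Lemma is_series_single (n : nat) (c : R) : is_series (fun i => if Nat.eqb i n then c else 0) c.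
Proof.
induction n as [|n IH].
- apply is_series_decr_1; simpl.
  assert (H := is_series_scal 0 _ _ (is_series_geom 0 ltac:(rewrite Rabs_R0; lra))).
  apply (is_series_ext _ (fun _ => 0)) in H; [|intros n; apply Rmult_0_l].
  unfold scal, plus, opp in *; simpl in *; unfold mult in H; simpl in H.
  now rewrite Rmult_0_l in H; rewrite Rplus_opp_r.
- apply is_series_decr_1; simpl.
  unfold plus, opp; simpl; now rewrite Ropp_0, Rplus_0_r.
Qed.

Lemma Series_ge_term (f : nat -> R) (i : nat) :
  ex_series f -> (forall j, 0 <= f j) -> f i <= Series f.
Proof.
intros Hf Hp.
rewrite <- (is_series_unique _ _ (is_series_single i (f i))).
apply Series_le; trivial.
intros j; destruct (Nat.eqb_spec j i); [subst; split; [apply Hp|lra]|split; [lra|apply Hp]].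
Qed.

(** * The spaces [ℓ_p] *)

Section Lp.
Variables (p : R) (Hp : 1 <= p).

Let mem := seq_mem (Fin p).
Let nr := seq_norm (Fin p).
Let S (f : nat -> R) := Series (fun i => rpw (Rabs (f i)) p).

Lemma Lp_S_nonneg (f : nat -> R) : mem f -> 0 <= S f.
Proof.
intros Hf; transitivity (rpw (Rabs (f 0%nat)) p); [apply rpw_nonneg|].
apply (Series_ge_term (fun i => rpw (Rabs (f i)) p) 0 Hf); intros; apply rpw_nonneg.
Qed.

Lemma Lp_pow_norm (f : nat -> R) : mem f -> rpw (nr f) p = S f.
Proof. intros Hf; apply rpw_rpw; [now apply Lp_S_nonneg | field; lra]. Qed.

Lemma Lp_norm_le (f : nat -> R) (B : R) : 0 <= B -> S f <= rpw B p -> nr f <= B.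
Proof.
intros HB H; rewrite <- (rpw_rpw B p (1 / p)); [|lra|field; lra].
apply rpw_le; trivial; apply Rdiv_lt_0_compat; lra.
Qed.

Lemma Lp_S_le (f g : nat -> R) : mem f -> mem g -> nr f <= nr g -> S f <= S g.
Proof.
intros Hf Hg H; rewrite <- !Lp_pow_norm by trivial; apply rpw_le; trivial; lra.
Qed.

Lemma Lp_norm_le_S (f g : nat -> R) : S f <= S g -> nr f <= nr g.
Proof. intros H; apply rpw_le; trivial; apply Rdiv_lt_0_compat; lra. Qed.

Lemma Lp_lat (f g : nat -> R) : mem g -> (forall i, Rabs (f i) <= Rabs (g i)) ->
  mem f /\ nr f <= nr g.
Proof.
intros Hg H.
assert (K : forall i, 0 <= rpw (Rabs (f i)) p <= rpw (Rabs (g i)) p)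
  by (intros i; split; [apply rpw_nonneg | apply rpw_le; [lra|apply H]]).
split.
- apply (ex_series_le (fun i => rpw (Rabs (f i)) p) (fun i => rpw (Rabs (g i)) p)); trivial.
  intros i; unfold norm; simpl; unfold abs; simpl.
  rewrite Rabs_pos_eq; apply K.
- apply Lp_norm_le_S, Series_le; trivial.
Qed.

Lemma Lp_coord (f : nat -> R) (i : nat) : mem f -> Rabs (f i) <= nr f.
Proof.
intros Hf; rewrite <- (rpw_rpw (Rabs (f i)) p (1 / p)); [|apply Rabs_pos|field; lra].
apply rpw_le; [apply Rdiv_lt_0_compat; lra|].
apply (Series_ge_term (fun i => rpw (Rabs (f i)) p) i Hf); intros; apply rpw_nonneg.
Qed.

Lemma Lp_scal (c : R) (f : nat -> R) : mem f ->
  mem (fun i => c * f i) /\ nr (fun i => c * f i) = Rabs c * nr f.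
Proof.
intros Hf.
assert (E : forall i, rpw (Rabs c) p * rpw (Rabs (f i)) p = rpw (Rabs (c * f i)) p)
  by (intros i; rewrite Rabs_mult, rpw_mult; auto using Rabs_pos).
split.
- apply (ex_series_ext (fun i => rpw (Rabs c) p * rpw (Rabs (f i)) p)); trivial.
  now apply (ex_series_scal (V:=R_NormedModule) (rpw (Rabs c) p)).
- unfold nr, seq_norm; rewrite <- (Series_ext _ _ E), Series_scal_l.
  rewrite rpw_mult; [|apply rpw_nonneg|now apply Lp_S_nonneg].
  rewrite rpw_rpw; [reflexivity|apply Rabs_pos|field; lra].
Qed.

(* Minkowski: convexity of [t^p] at the point [(f + g)/(|f| + |g|)], a convex
   combination of [f/|f|] and [g/|g|]. *)
Lemma Lp_add (f g : nat -> R) : mem f -> mem g ->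
  mem (fun i => f i + g i) /\ nr (fun i => f i + g i) <= nr f + nr g.
Proof.
intros Hf Hg.
assert (F0 : 0 <= nr f) by apply rpw_nonneg.
assert (G0 : 0 <= nr g) by apply rpw_nonneg.
assert (Z : forall h, mem h -> 0 = nr h -> forall i, h i = 0).
{ intros h Hh E i; assert (H := Lp_coord h i Hh); rewrite <- E in H.
  destruct (Req_dec (h i) 0) as [|n]; trivial; apply Rabs_pos_lt in n; lra. }
destruct F0 as [F0|F0].
2: { replace (fun i => f i + g i) with g; [split; [assumption|lra]|].
     extensionality i; rewrite (Z f Hf F0 i); ring. }
destruct G0 as [G0|G0].
2: { replace (fun i => f i + g i) with f; [split; [assumption|lra]|].
     extensionality i; rewrite (Z g Hg G0 i); ring. }
set (F := nr f) in *; set (G := nr g) in *.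
assert (bd : forall i, 0 <= rpw (Rabs (f i + g i)) p <=
   rpw (F + G) p * (F / (F + G) * / rpw F p) * rpw (Rabs (f i)) p +
   rpw (F + G) p * (G / (F + G) * / rpw G p) * rpw (Rabs (g i)) p).
{ intros i; split; [apply rpw_nonneg|].
  assert (q : forall H h, 0 < H -> 0 <= h -> / rpw H p * rpw h p = rpw (h / H) p).
  { intros H h HH Hh.
    assert (0 < rpw H p) by (rewrite rpw_pos by lra; apply exp_pos).
    replace h with (H * (h / H)) at 1 by (field; lra).
    rewrite rpw_mult; [field; lra|lra|apply Rdiv_le_0_compat; lra]. }
  assert (l1 : 0 <= G / (F + G) <= 1).
  { split; [apply Rdiv_le_0_compat; lra|].
    apply Rmult_le_reg_r with (F + G); [lra|].
    unfold Rdiv; rewrite Rmult_assoc, Rinv_l; lra. }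
  assert (fi := Rabs_pos (f i)); assert (gi := Rabs_pos (g i)).
  assert (f1 : 0 <= Rabs (f i) / F) by (apply Rdiv_le_0_compat; lra).
  assert (g1 : 0 <= Rabs (g i) / G) by (apply Rdiv_le_0_compat; lra).
  transitivity (rpw (Rabs (f i) + Rabs (g i)) p); [apply rpw_le; [lra|apply Rabs_triang]|].
  replace (Rabs (f i) + Rabs (g i)) with
    ((F + G) * ((1 - G / (F + G)) * (Rabs (f i) / F) + G / (F + G) * (Rabs (g i) / G)))
    by (field; lra).
  rewrite rpw_mult; [|lra|nra].
  rewrite !Rmult_assoc, !q by lra.
  rewrite <- Rmult_plus_distr_l.
  apply Rmult_le_compat_l; [apply rpw_nonneg|].
  replace (F / (F + G)) with (1 - G / (F + G)) by (field; lra).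
  now apply rpw_convex. }
assert (ex : ex_series (fun i =>
   rpw (F + G) p * (F / (F + G) * / rpw F p) * rpw (Rabs (f i)) p +
   rpw (F + G) p * (G / (F + G) * / rpw G p) * rpw (Rabs (g i)) p)).
{ apply (ex_series_plus (V:=R_NormedModule)); now apply (ex_series_scal (V:=R_NormedModule)). }
split.
- apply (ex_series_le (fun i => rpw (Rabs (f i + g i)) p) _ ) with (2 := ex).
  intros i; unfold norm; simpl; unfold abs; simpl; rewrite Rabs_pos_eq; apply bd.
- apply Lp_norm_le; [lra|].
  eapply Rle_trans; [apply Series_le; [exact bd|exact ex]|].
  rewrite Series_plus by now apply (ex_series_scal (V:=R_NormedModule)).
  rewrite !Series_scal_l; fold (S f) (S g); rewrite <- !Lp_pow_norm by trivial; fold F G.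
  assert (0 < rpw F p) by (rewrite rpw_pos by lra; apply exp_pos).
  assert (0 < rpw G p) by (rewrite rpw_pos by lra; apply exp_pos).
  right; field; lra.
Qed.

Lemma Lp_tail (f : nat -> R) (eps : R) : mem f -> 0 < eps ->
  exists t, nr (fun i => if Nat.leb t i then f i else 0) < eps.
Proof.
intros Hf He.
set (h := fun i => rpw (Rabs (f i)) p).
assert (Hl : is_lim_seq (sum_n h) (S f)) by exact (Series_correct h Hf).
apply is_lim_seq_spec in Hl.
assert (He2 : 0 < rpw (eps / 2) p) by (rewrite rpw_pos by lra; apply exp_pos).
destruct (Hl (mkposreal _ He2)) as [t Ht]; simpl in Ht.
specialize (Ht t (le_n t)).
(* [sum_n h t] includes the term of index [t], so the tail starts at [S t]. Passing through
   [eps / 2] turns the weak bound of [Lp_norm_le] into a strict one. *)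
exists (Datatypes.S t); apply Rle_lt_trans with (eps / 2); [|lra].
apply Lp_norm_le; [lra|].
enough (E : S (fun i => if Nat.leb (Datatypes.S t) i then f i else 0) = S f - sum_n h t).
{ rewrite E; apply Rabs_def2 in Ht; lra. }
unfold S; fold h.
rewrite (Series_incr_n h (Datatypes.S t)) by (try lia; exact Hf).
rewrite (Series_incr_n (fun i => rpw (Rabs (if Nat.leb (Datatypes.S t) i then f i else 0)) p)
  (Datatypes.S t)).
- assert (Z : sum_f_R0 (fun i => rpw (Rabs (if Nat.leb (Datatypes.S t) i then f i else 0)) p)
     (Init.Nat.pred (Datatypes.S t)) = 0).
  { rewrite (sum_eq _ (fun _ => 0)); [rewrite sum_cte; lra|].
    intros i Hi; destruct (Nat.leb_spec (Datatypes.S t) i); [simpl in Hi; lia|].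
    now rewrite Rabs_R0, rpw_0. }
  rewrite Z, Rplus_0_l, sum_n_Reals; simpl.
  rewrite (Series_ext _ (fun k => h (Datatypes.S (t + k)))); [lra|].
  intros k; unfold h; destruct (Nat.leb_spec t (t + k)); [reflexivity|lia].
- lia.
- apply (Lp_lat _ f Hf); intros i; destruct (Nat.leb (Datatypes.S t) i); [lra|].
  rewrite Rabs_R0; apply Rabs_pos.
Qed.

Lemma Lp_unit (n : nat) : mem (unit_seq n) /\ nr (unit_seq n) = 1.
Proof.
assert (H : is_series (fun i => rpw (Rabs (unit_seq n i)) p) 1).
{ apply (is_series_ext (fun i => if Nat.eqb i n then 1 else 0)); [|apply is_series_single].
  intros i; unfold unit_seq; destruct (Nat.eqb i n);
    rewrite ?Rabs_R1, ?Rabs_R0, ?rpw_1, ?rpw_0; reflexivity. }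
split; [now exists 1|].
unfold nr, seq_norm; rewrite (is_series_unique _ _ H); apply rpw_1.
Qed.

(** On disjoint supports the [p]-th powers of the norms add up, and taking powers is monotone. *)
Lemma Lp_disj (f g f' g' : nat -> R) : mem f -> mem g -> mem f' -> mem g' ->
  (forall i, f i = 0 \/ g i = 0) -> (forall i, f' i = 0 \/ g' i = 0) ->
  nr f <= nr f' -> nr g <= nr g' -> nr (fun i => f i + g i) <= nr (fun i => f' i + g' i).
Proof.
intros Hf Hg Hf' Hg' D D' Lf Lg; apply Lp_norm_le_S.
assert (E : forall f g, mem f -> mem g -> (forall i, f i = 0 \/ g i = 0) ->
  S (fun i => f i + g i) = S f + S g).
{ clear; intros f g Hf Hg D; unfold S; rewrite <- Series_plus by trivial.
  apply Series_ext; intros i; destruct (D i) as [-> | ->];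
    rewrite Rabs_R0, rpw_0, ?Rplus_0_l, ?Rplus_0_r; ring. }
rewrite !E by trivial.
apply Lp_S_le in Lf; trivial; apply Lp_S_le in Lg; trivial; lra.
Qed.

Lemma Lp_lat_seq : lat_seq mem nr.
Proof.
constructor; [exact Lp_lat|exact Lp_add|exact Lp_scal|exact Lp_coord|exact Lp_unit
  |exact Lp_tail|exact Lp_disj].
Qed.
End Lp.

(** * The space [c_0] *)

Lemma c0_bounded (f : nat -> R) : seq_mem Czero f -> exists M, forall i, Rabs (f i) <= M.
Proof.
intros Hf; apply is_lim_seq_spec in Hf; destruct (Hf (mkposreal 1 Rlt_0_1)) as [n Hn].
assert (H : forall n, exists M, forall i, (i < n)%nat -> Rabs (f i) <= M).
{ induction n0 as [|m [M HM]]; [exists 0; intros; lia|].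
  exists (Rmax M (Rabs (f m))); intros i Hi.
  destruct (Nat.eq_dec i m) as [->|]; [apply Rmax_r|].
  eapply Rle_trans; [apply HM; lia|apply Rmax_l]. }
destruct (H n) as [M HM]; exists (Rmax M 1); intros i.
destruct (Nat.lt_ge_cases i n) as [Hi|Hi].
- eapply Rle_trans; [now apply HM|apply Rmax_l].
- eapply Rle_trans; [|apply Rmax_r]; specialize (Hn i Hi); simpl in Hn.
  rewrite Rminus_0_r in Hn; lra.
Qed.

(** The norm is [real] of an extended supremum, hence [0] if that supremum is infinite; boundedness
    of null sequences has to exclude this case. *)
Lemma c0_coord (f : nat -> R) (i : nat) :
  seq_mem Czero f -> Rabs (f i) <= seq_norm Czero f.
Proof.
intros Hf; destruct (c0_bounded f Hf) as [M HM]; unfold seq_norm.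
assert (H := Sup_seq_correct (fun i => Rabs (f i))).
destruct (Sup_seq (fun i => Rabs (f i))) as [r| |]; simpl in *.
- apply Rle_plus_epsilon; intros eps He.
  destruct (H (mkposreal eps He)) as [H1 _]; specialize (H1 i); simpl in H1; lra.
- destruct (H M) as [n Hn]; specialize (HM n); simpl in Hn; lra.
- specialize (H 0 i); simpl in H; assert (G := Rabs_pos (f i)); lra.
Qed.

Lemma c0_norm_le (f : nat -> R) (B : R) :
  (forall i, Rabs (f i) <= B) -> seq_norm Czero f <= B.
Proof.
intros HM; unfold seq_norm.
assert (H := Sup_seq_correct (fun i => Rabs (f i))).
destruct (Sup_seq (fun i => Rabs (f i))) as [r| |]; simpl in *.
- apply Rle_plus_epsilon; intros eps He.
  destruct (H (mkposreal eps He)) as [_ [n Hn]]; simpl in Hn; specialize (HM n); lra.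
(* [real] turns an infinite supremum into [0], which is at most [B] because [B] bounds an absolute
   value. *)
- eapply Rle_trans; [apply Rabs_pos|apply (HM 0%nat)].
- eapply Rle_trans; [apply Rabs_pos|apply (HM 0%nat)].
Qed.

Lemma c0_lat_seq : lat_seq (seq_mem Czero) (seq_norm Czero).
Proof.
assert (lat : forall f g, seq_mem Czero g -> (forall i, Rabs (f i) <= Rabs (g i)) ->
   seq_mem Czero f /\ seq_norm Czero f <= seq_norm Czero g).
{ intros f g Hg H; split.
  - apply is_lim_seq_abs_0.
    apply (is_lim_seq_le_le (fun _ => 0) _ (fun n => Rabs (g n))).
    + intros n; split; [apply Rabs_pos|apply H].
    + apply is_lim_seq_const.
    + now apply -> is_lim_seq_abs_0.
  - apply c0_norm_le; intros i; eapply Rle_trans; [apply H|now apply c0_coord]. }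
assert (scal : forall c f, seq_mem Czero f -> seq_mem Czero (fun i => c * f i) /\
  seq_norm Czero (fun i => c * f i) <= Rabs c * seq_norm Czero f).
{ intros c f Hf; split.
  - simpl; replace (Finite 0) with (Rbar_mult c 0) by (simpl; f_equal; ring).
    now apply is_lim_seq_scal_l.
  - apply c0_norm_le; intros i; rewrite Rabs_mult.
    apply Rmult_le_compat_l; [apply Rabs_pos|now apply c0_coord]. }
constructor; trivial.
- intros f g Hf Hg; split.
  + simpl; replace (Finite 0) with (Finite (0 + 0)) by (f_equal; ring).
    now apply is_lim_seq_plus'.
  + apply c0_norm_le; intros i; eapply Rle_trans; [apply Rabs_triang|].
    apply Rplus_le_compat; now apply c0_coord.
- intros c f Hf; destruct (scal c f Hf) as [H1 H2]; split; trivial.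
  apply Rle_antisym; trivial.
  destruct (Req_dec c 0) as [->|Hc].
  + rewrite Rabs_R0, Rmult_0_l; eapply Rle_trans; [apply Rabs_pos|].
    exact (c0_coord _ 0%nat H1).
  + destruct (scal (/ c) _ H1) as [_ H3].
    replace (fun i => / c * (c * f i)) with f in H3 by (extensionality i; field; trivial).
    rewrite Rabs_inv in H3; apply Rabs_pos_lt in Hc.
    apply (Rmult_le_compat_l (Rabs c)) in H3; [|lra].
    rewrite <- Rmult_assoc, Rinv_r, Rmult_1_l in H3; lra.
- intros; now apply c0_coord.
- intros n; assert (H : seq_mem Czero (unit_seq n)).
  { apply (is_lim_seq_ext_loc (fun _ => 0)); [|apply is_lim_seq_const].
    exists (S n); intros i Hi; unfold unit_seq; destruct (Nat.eqb_spec i n); [lia|reflexivity]. }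
  split; trivial; apply Rle_antisym.
  + apply c0_norm_le; intros i; unfold unit_seq; destruct (Nat.eqb i n);
      rewrite ?Rabs_R1, ?Rabs_R0; lra.
  + assert (G := c0_coord _ n H); unfold unit_seq at 1 in G.
    now rewrite Nat.eqb_refl, Rabs_R1 in G.
- intros f eps Hf He; apply is_lim_seq_spec in Hf.
  assert (He2 : 0 < eps / 2) by lra.
  destruct (Hf (mkposreal _ He2)) as [t Ht]; simpl in Ht; exists t.
  apply Rle_lt_trans with (eps / 2); [|lra].
  apply c0_norm_le; intros i; destruct (Nat.leb_spec t i).
  + specialize (Ht i H); rewrite Rminus_0_r in Ht; lra.
  + rewrite Rabs_R0; lra.
- intros f g f' g' Hf Hg Hf' Hg' D D' Lf Lg.
  assert (Hs : seq_mem Czero (fun i => f' i + g' i)).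
  { simpl; replace (Finite 0) with (Finite (0 + 0)) by (f_equal; ring).
    now apply is_lim_seq_plus'. }
  apply c0_norm_le; intros i; destruct (D i) as [-> | ->].
  + rewrite Rplus_0_l; eapply Rle_trans; [now apply c0_coord|].
    eapply Rle_trans; [apply Lg|]; apply lat; trivial.
    intros k; destruct (D' k) as [-> | ->]; rewrite ?Rabs_R0, ?Rplus_0_l; [lra|apply Rabs_pos].
  + rewrite Rplus_0_r; eapply Rle_trans; [now apply c0_coord|].
    eapply Rle_trans; [apply Lf|]; apply lat; trivial.
    intros k; destruct (D' k) as [-> | ->]; rewrite ?Rabs_R0, ?Rplus_0_r; [apply Rabs_pos|lra].
Qed.

Definition valid (e : expo) : Prop := match e with Fin p => 1 <= p | Czero => True end.

Lemma valid_lat_seq (e : expo) : valid e -> lat_seq (seq_mem e) (seq_norm e).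
Proof. destruct e as [p|]; intros H; [now apply Lp_lat_seq|apply c0_lat_seq]. Qed.

(** * Finite sums and the diagonal extraction *)

Lemma fsum_ext (N : nat) (f g : nat -> R) :
  (forall k, (k < N)%nat -> f k = g k) -> fsum N f = fsum N g.
Proof.
induction N as [|N IH]; intros H; simpl; trivial.
now rewrite IH, H by auto with arith.
Qed.

Lemma fsum_0 (N : nat) (f : nat -> R) : (forall k, (k < N)%nat -> f k = 0) -> fsum N f = 0.
Proof.
induction N as [|N IH]; intros H; simpl; trivial.
rewrite IH, H by auto with arith; ring.
Qed.

Lemma fsum_plus (N : nat) (f g : nat -> R) :
  fsum N (fun k => f k + g k) = fsum N f + fsum N g.
Proof. induction N as [|N IH]; simpl; [ring|rewrite IH; ring]. Qed.

Lemma fsum_scal (N : nat) (c : R) (f : nat -> R) : fsum N (fun k => c * f k) = c * fsum N f.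
Proof. induction N as [|N IH]; simpl; [ring|rewrite IH; ring]. Qed.

Lemma fsum_swap (N M : nat) (f : nat -> nat -> R) :
  fsum N (fun i => fsum M (fun j => f i j)) = fsum M (fun j => fsum N (fun i => f i j)).
Proof.
induction N as [|N IH]; simpl; [now rewrite fsum_0|].
now rewrite IH, fsum_plus.
Qed.

Lemma fsum_le (N : nat) (f g : nat -> R) :
  (forall k, (k < N)%nat -> f k <= g k) -> fsum N f <= fsum N g.
Proof.
induction N as [|N IH]; intros H; simpl; [lra|].
apply Rplus_le_compat; auto with arith.
Qed.

Lemma fsum_abs (N : nat) (f : nat -> R) : Rabs (fsum N f) <= fsum N (fun k => Rabs (f k)).
Proof.
induction N as [|N IH]; simpl; [rewrite Rabs_R0; lra|].
eapply Rle_trans; [apply Rabs_triang|lra].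
Qed.

Lemma fsum_const (N : nat) (c : R) : fsum N (fun _ => c) = INR N * c.
Proof. induction N as [|N IH]; [simpl; ring|]; rewrite S_INR; simpl; rewrite IH; ring. Qed.

Lemma fsum_single (N n : nat) (f : nat -> R) : (n < N)%nat ->
  (forall k, (k < N)%nat -> k <> n -> f k = 0) -> fsum N f = f n.
Proof.
induction N as [|N IH]; intros Hn H; simpl; [lia|].
destruct (Nat.eq_dec n N) as [->|E].
- rewrite fsum_0; [ring|intros k Hk; apply H; lia].
- rewrite IH, (H N) by (try intros; try apply H; lia); ring.
Qed.

Lemma fsum_extend (N M : nat) (f : nat -> R) : (N <= M)%nat ->
  (forall k, (N <= k)%nat -> f k = 0) -> fsum M f = fsum N f.
Proof.
induction 1 as [|M HM IH]; intros H; trivial; simpl.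
rewrite IH, (H M) by trivial; ring.
Qed.

Lemma Rabs_m1 : Rabs (-1) = 1.
Proof. unfold Rabs; destruct (Rcase_abs (-1)); lra. Qed.

Definition signs (eps : nat -> R) : Prop := forall k, eps k = 1 \/ eps k = -1.

Lemma signs_abs (eps : nat -> R) (k : nat) : signs eps -> Rabs (eps k) = 1.
Proof. intros H; destruct (H k) as [-> | ->]; [apply Rabs_R1|apply Rabs_m1]. Qed.

(** Averaging over the last sign [s = 1, -1] removes the mixed terms that contain the index [N], and
    the term [t N N] moves into the accumulator [t0]. Asking of [K] only that it contain midpoints
    covers both norm balls and strict inequalities for one entry. *)
Lemma diag_extraction (K : mat -> Prop)
  (Kmid : forall y z : mat, K y -> K z -> K (fun i j => (y i j + z i j) / 2))
  (N : nat) (t : nat -> nat -> mat) (t0 : mat) :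
  (forall th, signs th -> K (fun i j => t0 i j +
      fsum N (fun a => fsum N (fun b => th a * th b * t a b i j)))) ->
  K (fun i j => t0 i j + fsum N (fun a => t a a i j)).
Proof.
revert t0; induction N as [|N IH]; intros t0 H.
- exact (H (fun _ => 1) (fun _ => or_introl eq_refl)).
- replace (fun i j => t0 i j + fsum (S N) (fun a => t a a i j)) with
    (fun i j => (t0 i j + t N N i j) + fsum N (fun a => t a a i j))
    by (extensionality i; extensionality j; simpl; ring).
  apply (IH (fun i j => t0 i j + t N N i j)); intros th Hth.
  set (ths := fun (s : R) k => if Nat.eqb k N then s else th k).
  assert (E : forall s i j, s * s = 1 -> t0 i j +
      fsum (S N) (fun a => fsum (S N) (fun b => ths s a * ths s b * t a b i j)) =
      t0 i j + t N N i j + fsum N (fun a => fsum N (fun b => th a * th b * t a b i j))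
      + s * fsum N (fun a => th a * (t a N i j + t N a i j))).
  { intros s i j Hs; simpl.
    assert (sN : ths s N = s) by (unfold ths; now rewrite Nat.eqb_refl).
    assert (sk : forall k, (k < N)%nat -> ths s k = th k)
      by (intros k Hk; unfold ths; destruct (Nat.eqb_spec k N); [lia|reflexivity]).
    rewrite sN, Hs, fsum_plus.
    rewrite (fsum_ext N (fun a => ths s a * s * t a N i j) (fun a => s * (th a * t a N i j)))
      by (intros k Hk; rewrite sk by trivial; ring).
    rewrite (fsum_ext N (fun a => s * ths s a * t N a i j) (fun a => s * (th a * t N a i j)))
      by (intros k Hk; rewrite sk by trivial; ring).
    rewrite (fsum_ext N (fun a => fsum N (fun b => ths s a * ths s b * t a b i j))
      (fun a => fsum N (fun b => th a * th b * t a b i j)))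
      by (intros k Hk; apply fsum_ext; intros l Hl; rewrite !sk by trivial; ring).
    rewrite (fsum_ext N (fun a => th a * (t a N i j + t N a i j))
      (fun a => th a * t a N i j + th a * t N a i j)) by (intros; ring).
    rewrite fsum_plus, !fsum_scal; ring. }
  assert (S1 : signs (ths 1)) by (intros k; unfold ths; destruct (Nat.eqb k N); auto).
  assert (S2 : signs (ths (-1))) by (intros k; unfold ths; destruct (Nat.eqb k N); auto).
  assert (H3 := Kmid _ _ (H _ S1) (H _ S2)).
  match goal with |- K ?u => match type of H3 with K ?v => replace u with v; [exact H3|] end end.
  extensionality i; extensionality j; rewrite !E by ring; field.
Qed.

(** For a disjoint family this is the value attached to the member containing [t], and [0] off the
    union. Written as a sum, it can be interchanged with sums of vectors. *)
Definition select {T : Type} (N : nat) (th : nat -> R) (D : nat -> T -> bool) (t : T) : R :=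
  fsum N (fun j => if D j t then th j else 0).

Definition disjoint_family {T : Type} (D : nat -> T -> bool) : Prop :=
  forall i j t, D i t = true -> D j t = true -> i = j.

Lemma select_in {T : Type} (N : nat) (th : nat -> R) (D : nat -> T -> bool) (t : T) (j : nat) :
  disjoint_family D -> (j < N)%nat -> D j t = true -> select N th D t = th j.
Proof.
intros HD Hj Ht; unfold select; rewrite (fsum_single N j); trivial; [now rewrite Ht|].
intros k _ Hk; destruct (D k t) eqn:E; trivial; now elim Hk; apply (HD k j t).
Qed.

Lemma select_bound {T : Type} (N : nat) (th : nat -> R) (D : nat -> T -> bool) (t : T) (B : R) :
  disjoint_family D -> 0 <= B -> (forall k, Rabs (th k) <= B) -> Rabs (select N th D t) <= B.
Proof.
intros HD HB Hth.
destruct (classic (exists j, (j < N)%nat /\ D j t = true)) as [[j [Hj E]]|H].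
- rewrite (select_in N th D t j); trivial.
- unfold select; rewrite fsum_0; [now rewrite Rabs_R0|].
  intros k Hk; destruct (D k t) eqn:E; trivial; elim H; now exists k.
Qed.

(** * Lattice norms on matrices *)

Definition unit_mat (p q : nat) : mat :=
  fun i j => if (Nat.eqb i p && Nat.eqb j q)%bool then 1 else 0.
Definition msum (N : nat) (w : nat -> mat) : mat := fun i j => fsum N (fun k => w k i j).
Definition madd (y z : mat) : mat := fun i j => y i j + z i j.
Definition mscal (c : R) (y : mat) : mat := fun i j => c * y i j.
Definition proj (J : nat * nat -> bool) (y : mat) : mat :=
  fun i j => if J (i, j) then y i j else 0.

Record lat_mat (X : mat -> Prop) (nrm : mat -> R) : Prop := {
  lm_lat : forall y z, X z -> (forall i j, Rabs (y i j) <= Rabs (z i j)) -> X y /\ nrm y <= nrm z;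
  lm_add : forall y z, X y -> X z -> X (madd y z) /\ nrm (madd y z) <= nrm y + nrm z;
  lm_scal : forall c y, X y -> X (mscal c y) /\ nrm (mscal c y) = Rabs c * nrm y;
  lm_coord : forall y i j, X y -> Rabs (y i j) <= nrm y;
  lm_unit : forall p q, X (unit_mat p q) /\ nrm (unit_mat p q) = 1 }.

Section Lattice.
Variables (X : mat -> Prop) (nrm : mat -> R) (L : lat_mat X nrm).

Lemma nrm_nonneg (y : mat) : X y -> 0 <= nrm y.
Proof. intros H; eapply Rle_trans; [apply Rabs_pos|exact (lm_coord _ _ L y 0%nat 0%nat H)]. Qed.

Lemma X_0 : X (fun _ _ => 0).
Proof.
apply (lm_lat _ _ L _ (unit_mat 0 0)); [apply (lm_unit _ _ L)|].
intros; rewrite Rabs_R0; apply Rabs_pos.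
Qed.

Lemma nrm_0 : nrm (fun _ _ => 0) = 0.
Proof.
assert (H := lm_scal _ _ L 0 _ X_0); rewrite Rabs_R0, Rmult_0_l in H.
destruct H as [_ H]; etransitivity; [|exact H]; f_equal; unfold mscal.
extensionality i; extensionality j; ring.
Qed.

Lemma X_add (y z : mat) : X y -> X z -> X (madd y z).
Proof. intros; now apply (lm_add _ _ L). Qed.

Lemma X_scal (c : R) (y : mat) : X y -> X (mscal c y).
Proof. intros; now apply (lm_scal _ _ L). Qed.

Lemma msub_madd (y z : mat) : msub y z = madd y (mscal (-1) z).
Proof. extensionality i; extensionality j; unfold msub, madd, mscal; ring. Qed.

Lemma X_sub (y z : mat) : X y -> X z -> X (msub y z).
Proof. intros; rewrite msub_madd; now apply X_add; [|apply X_scal]. Qed.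

Lemma nrm_sub (y z : mat) : X y -> X z -> nrm (msub y z) <= nrm y + nrm z.
Proof.
intros Hy Hz; rewrite msub_madd.
eapply Rle_trans; [apply (lm_add _ _ L); trivial; now apply X_scal|].
rewrite (proj2 (lm_scal _ _ L (-1) z Hz)), Rabs_m1; lra.
Qed.

Lemma nrm_sub_sym (y z : mat) : X y -> X z -> nrm (msub y z) = nrm (msub z y).
Proof.
intros Hy Hz; replace (msub y z) with (mscal (-1) (msub z y)).
- rewrite (proj2 (lm_scal _ _ L (-1) _ (X_sub z y Hz Hy))), Rabs_m1; ring.
- extensionality i; extensionality j; unfold msub, mscal; ring.
Qed.

Lemma nrm_triangle (y z w : mat) : X y -> X z -> X w ->
  nrm (msub y w) <= nrm (msub y z) + nrm (msub z w).
Proof.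
intros Hy Hz Hw; replace (msub y w) with (madd (msub y z) (msub z w)).
- apply (lm_add _ _ L); now apply X_sub.
- extensionality i; extensionality j; unfold msub, madd; ring.
Qed.

Lemma X_proj (J : nat * nat -> bool) (y : mat) : X y -> X (proj J y).
Proof.
intros Hy; apply (lm_lat _ _ L _ y Hy); intros i j; unfold proj.
destruct (J (i, j)); [lra|rewrite Rabs_R0; apply Rabs_pos].
Qed.

Lemma nrm_proj (J : nat * nat -> bool) (y : mat) : X y -> nrm (proj J y) <= nrm y.
Proof.
intros Hy; apply (lm_lat _ _ L _ y Hy); intros i j; unfold proj.
destruct (J (i, j)); [lra|rewrite Rabs_R0; apply Rabs_pos].
Qed.

Lemma nrm_mult_le (r : mat) (B : R) (y : mat) : X y -> 0 <= B -> (forall i j, Rabs (r i j) <= B) ->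
  X (fun i j => r i j * y i j) /\ nrm (fun i j => r i j * y i j) <= B * nrm y.
Proof.
intros Hy HB Hr.
destruct (lm_scal _ _ L B y Hy) as [H1 H2]; rewrite Rabs_pos_eq in H2 by trivial.
rewrite <- H2; apply (lm_lat _ _ L); trivial.
intros i j; unfold mscal; rewrite !Rabs_mult, (Rabs_pos_eq B) by trivial.
apply Rmult_le_compat_r; [apply Rabs_pos|trivial].
Qed.

Lemma X_msum (N : nat) (w : nat -> mat) : (forall k, (k < N)%nat -> X (w k)) -> X (msum N w).
Proof.
induction N as [|N IH]; intros H; [exact X_0|].
apply (X_add (msum N w) (w N)); auto with arith.
Qed.

Lemma X_lcomb (N : nat) (a : nat -> R) (x : nat -> mat) :
  (forall k, X (x k)) -> X (lcomb N a x).
Proof. intros H; apply (X_msum N (fun k => mscal (a k) (x k))); intros; now apply X_scal. Qed.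

(** The ball of radius [B] in [X] is convex, so the diagonal can be extracted inside it. *)
Lemma nrm_diag (N : nat) (t : nat -> nat -> mat) (B : R) : (forall a b, X (t a b)) ->
  (forall th, signs th -> nrm (msum N (fun a => msum N (fun b => mscal (th a * th b) (t a b)))) <= B) ->
  nrm (msum N (fun a => t a a)) <= B.
Proof.
intros Ht H.
assert (G := fun Km => diag_extraction (fun y => X y /\ nrm y <= B) Km N t (fun _ _ => 0)).
cbv beta in G.
assert (E : forall y : mat, (fun i j => 0 + y i j) = y)
  by (intros y; extensionality i; extensionality j; ring).
rewrite (E (fun i j => fsum N (fun a => t a a i j))) in G; apply G.
- clear - L; intros y z [Hy By] [Hz Bz].
  replace (fun i j => (y i j + z i j) / 2) with (mscal (/ 2) (madd y z))
    by (extensionality i; extensionality j; unfold mscal, madd; field).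
  destruct (lm_add _ _ L y z Hy Hz) as [H1 H2].
  destruct (lm_scal _ _ L (/ 2) _ H1) as [H3 H4]; split; trivial.
  rewrite H4, Rabs_pos_eq; lra.
- intros th Hth.
  rewrite (E (fun i j => fsum N (fun a => fsum N (fun b => th a * th b * t a b i j)))).
  split; [|now apply H].
  apply (X_msum N (fun a => msum N (fun b => mscal (th a * th b) (t a b)))).
  intros; apply X_msum; intros; now apply X_scal.
Qed.

(** Take [t a b = proj (J a) (w b)]: with signs, the double sum is the signed sum of the [w b]
    multiplied entrywise by the signs of the sets [J a], and this multiplication does not increase a
    lattice norm. *)
Lemma proj_diag (N : nat) (J : nat -> nat * nat -> bool) (w : nat -> mat) (B : R) :
  disjoint_family J -> (forall k, X (w k)) ->
  (forall th, signs th -> nrm (msum N (fun k => mscal (th k) (w k))) <= B) ->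
  nrm (msum N (fun k => proj (J k) (w k))) <= B.
Proof.
intros HJ Hw H.
apply (nrm_diag N (fun a b => proj (J a) (w b))); [intros; now apply X_proj|].
intros th Hth; eapply Rle_trans; [|apply (H th Hth)].
set (W := msum N (fun k => mscal (th k) (w k))).
assert (HW : X W) by (apply X_msum; intros; now apply X_scal).
destruct (nrm_mult_le (fun i j => select N th J (i, j)) 1 W HW) as [_ G]; [lra| |].
- intros i j; apply select_bound; trivial; [lra|].
  intros k; rewrite signs_abs by trivial; lra.
- rewrite Rmult_1_l in G; eapply Rle_trans; [right|exact G]; f_equal.
  extensionality i; extensionality j; unfold W, select, msum, mscal, proj.
  rewrite Rmult_comm, <- fsum_scal; apply fsum_ext; intros a _.
  destruct (J a (i, j)).
  + rewrite Rmult_comm, <- fsum_scal; apply fsum_ext; intros; ring.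
  + rewrite Rmult_0_r; apply fsum_0; intros; ring.
Qed.

(** On disjoint supports the coefficients [th k] act as one entrywise multiplier bounded by [B]. *)
Lemma nrm_flip (N : nat) (J : nat -> nat * nat -> bool) (v : nat -> mat) (th : nat -> R) (B : R) :
  disjoint_family J -> (forall k, X (v k)) -> (forall k, proj (J k) (v k) = v k) ->
  0 <= B -> (forall k, Rabs (th k) <= B) ->
  nrm (msum N (fun k => mscal (th k) (v k))) <= B * nrm (msum N v).
Proof.
intros HJ Hv Hp HB Hth.
destruct (nrm_mult_le (fun i j => select N th J (i, j)) B (msum N v)) as [_ G]; trivial.
- now apply X_msum.
- intros i j; now apply select_bound.
- eapply Rle_trans; [right|exact G]; f_equal.
  extensionality i; extensionality j; unfold msum, mscal.
  rewrite <- fsum_scal; apply fsum_ext; intros a Ha.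
  rewrite <- (Hp a); unfold proj; destruct (J a (i, j)) eqn:E; [|ring].
  now rewrite (select_in N th J (i, j) a).
Qed.
End Lattice.

(** * Unconditional bases *)

Lemma lim0_spec (u : nat -> R) :
  is_lim_seq u 0 <-> forall eps, 0 < eps -> exists N, forall n, (N <= n)%nat -> Rabs (u n) < eps.
Proof.
split.
- intros H eps He; apply is_lim_seq_spec in H; destruct (H (mkposreal eps He)) as [N HN].
  exists N; intros n Hn; specialize (HN n Hn); simpl in HN; now rewrite Rminus_0_r in HN.
- intros H; apply is_lim_seq_spec; intros eps; destruct (H eps (cond_pos eps)) as [N HN].
  exists N; intros n Hn; rewrite Rminus_0_r; auto.
Qed.

Lemma dependent_choice {A : Type} (R : A -> A -> Prop) (a0 : A) :
  (forall a, exists b, R a b) -> exists s : nat -> A, forall n, R (s n) (s (S n)).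
Proof.
intros H; pose (f := fun a => proj1_sig (constructive_indefinite_description _ (H a))).
exists (nat_rect (fun _ => A) a0 (fun _ => f)); intros n; simpl.
exact (proj2_sig (constructive_indefinite_description _ (H _))).
Qed.

Lemma increasing_le (f : nat -> nat) : (forall n, (f n <= f (S n))%nat) ->
  forall i j, (i <= j)%nat -> (f i <= f j)%nat.
Proof. intros H i j; induction 1 as [|j _ IH]; [lia|specialize (H j); lia]. Qed.

Lemma increasing_lt (f : nat -> nat) : (forall n, (f n < f (S n))%nat) ->
  forall i j, (i < j)%nat -> (f i < f j)%nat.
Proof. intros H i j; induction 1 as [|j _ IH]; [apply H|specialize (H j); lia]. Qed.

(** The biorthogonal functionals, all at once, as functions of [y]; the value is arbitrary when [y]
    has no expansion. *)
Definition coef (nrm : mat -> R) (x : nat -> mat) (y : mat) : nat -> R :=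
  epsilon (inhabits (fun _ => 0)) (fun a => expands nrm x y a).

Definition shell (T : nat -> nat * nat -> bool) (s t : nat) (p : nat * nat) : bool :=
  (T s p && negb (T t p))%bool.

Record region (X : mat -> Prop) (nrm : mat -> R) (T : nat -> nat * nat -> bool) : Prop := {
  region_mono : forall s t p, (s <= t)%nat -> T t p = true -> T s p = true;
  region_tail : forall y eps, X y -> 0 < eps -> exists t, nrm (proj (T t) y) < eps }.

(** Uniform bounds [c] and [C] replace norm one, since these vectors arise as restrictions, of which
    only such bounds are known. *)
Definition blocks (X : mat -> Prop) (nrm : mat -> R) (T : nat -> nat * nat -> bool)
  (v : nat -> mat) : Prop :=
  exists (s t : nat -> nat) (c C : R), 0 < c /\ forall j, (s j <= t j <= s (S j))%nat /\
    X (v j) /\ proj (shell T (s j) (t j)) (v j) = v j /\ c <= nrm (v j) <= C.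

Definition equivalent (nrm : mat -> R) (u v : nat -> mat) : Prop :=
  exists C, 0 < C /\ forall N a,
    nrm (lcomb N a u) <= C * nrm (lcomb N a v) /\ nrm (lcomb N a v) <= C * nrm (lcomb N a u).

Lemma shell_disjoint (X : mat -> Prop) (nrm : mat -> R) (T : nat -> nat * nat -> bool)
  (s t : nat -> nat) : region X nrm T -> (forall j, (s j <= t j <= s (S j))%nat) ->
  disjoint_family (fun j => shell T (s j) (t j)).
Proof.
intros HT Hst.
assert (H : forall i j p, (i < j)%nat -> shell T (s i) (t i) p = true ->
   shell T (s j) (t j) p = true -> False).
{ intros i j p Hij Hi Hj; apply Bool.andb_true_iff in Hi, Hj.
  destruct Hi as [_ Hi], Hj as [Hj _].
  assert (Hs : (t i <= s j)%nat).
  { destruct (Hst i) as [_ H]; apply (Nat.le_trans _ _ _ H).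
    apply increasing_le; [|lia]; intros n; specialize (Hst n); lia. }
  now rewrite (region_mono _ _ _ HT _ _ p Hs Hj) in Hi. }
intros i j p Hi Hj; destruct (Nat.lt_trichotomy i j) as [l|[e|l]]; trivial;
  [elim (H i j p l Hi Hj)|elim (H j i p l Hj Hi)].
Qed.

Lemma proj_shell (X : mat -> Prop) (nrm : mat -> R) (T : nat -> nat * nat -> bool)
  (s t : nat) (y : mat) : region X nrm T -> (s <= t)%nat ->
  proj (shell T s t) y = madd (proj (T s) y) (mscal (-1) (proj (T t) y)).
Proof.
intros HT Hst; extensionality i; extensionality j; unfold proj, madd, mscal, shell.
assert (H := region_mono _ _ _ HT s t (i, j) Hst).
destruct (T s (i, j)), (T t (i, j)); simpl; try ring; now specialize (H eq_refl).
Qed.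

Lemma proj_idem (J : nat * nat -> bool) (y : mat) : proj J (proj J y) = proj J y.
Proof.
extensionality i; extensionality j; unfold proj; now destruct (J (i, j)).
Qed.

Lemma proj_mscal (J : nat * nat -> bool) (c : R) (y : mat) :
  proj J (mscal c y) = mscal c (proj J y).
Proof.
extensionality i; extensionality j; unfold proj, mscal; destruct (J (i, j)); ring.
Qed.

Lemma mscal_mscal (c d : R) (y : mat) : mscal c (mscal d y) = mscal (c * d) y.
Proof. extensionality i; extensionality j; unfold mscal; ring. Qed.

(** * Coefficient functionals and multipliers of an unconditional basis *)

Section Basis.
Variables (X : mat -> Prop) (nrm : mat -> R) (L : lat_mat X nrm) (x : nat -> mat).
Hypothesis (Hb : schauder_basis X nrm x).
Variables (K m M : R) (HK : 1 <= K) (Hm : 0 < m).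
Hypothesis (Hu : forall N a eps, signs eps ->
  nrm (lcomb N (fun k => eps k * a k) x) <= K * nrm (lcomb N a x)).
Hypothesis (Hx : forall n, m <= nrm (x n) <= M).

Let Xx : forall n, X (x n) := proj1 Hb.
Let co := coef nrm x.
Let X_lc (N : nat) (a : nat -> R) : X (lcomb N a x) := X_lcomb X nrm L N a x Xx.
Let X_ad := X_add X nrm L.
Let X_sc := X_scal X nrm L.
Let X_sb := X_sub X nrm L.
Let X_ms := X_msum X nrm L.
Let X_pr := X_proj X nrm L.

Lemma lcomb_ext (N : nat) (a b : nat -> R) (u : nat -> mat) :
  (forall k, (k < N)%nat -> a k = b k) -> lcomb N a u = lcomb N b u.
Proof.
intros H; extensionality i; extensionality j; apply fsum_ext; intros k Hk; now rewrite H.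
Qed.

Lemma lcomb_extend (N N' : nat) (a : nat -> R) (u : nat -> mat) : (N <= N')%nat ->
  (forall k, (N <= k)%nat -> a k = 0) -> lcomb N' a u = lcomb N a u.
Proof.
intros HN H; extensionality i; extensionality j; apply fsum_extend; trivial.
intros k Hk; rewrite H by trivial; ring.
Qed.

(** A number in [[-1, 1]] is a convex combination of [1] and [-1], so the coordinates of [mu] can be
    replaced by signs one at a time without enlarging the constant; the induction counts the
    coordinates that are not yet signs. *)
Lemma multiplier_finite (N : nat) (a mu : nat -> R) : (forall k, Rabs (mu k) <= 1) ->
  nrm (lcomb N (fun k => mu k * a k) x) <= K * nrm (lcomb N a x).
Proof.
assert (P : forall n mu, (forall k, Rabs (mu k) <= 1) ->
  (forall k, (n <= k)%nat -> mu k = 1 \/ mu k = -1) ->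
  nrm (lcomb N (fun k => mu k * a k) x) <= K * nrm (lcomb N a x)).
{ clear mu; induction n as [|n IH]; intros mu H1 H2.
  - apply Hu; intros k; apply H2; lia.
  - set (r := fun (s : R) k => if Nat.eqb k n then s else mu k).
    assert (B : forall s, s = 1 \/ s = -1 ->
      nrm (lcomb N (fun k => r s k * a k) x) <= K * nrm (lcomb N a x)).
    { intros s Hs; apply IH; intros k; unfold r; destruct (Nat.eqb_spec k n); auto.
      - destruct Hs as [-> | ->]; rewrite ?Rabs_R1, ?Rabs_m1; lra.
      - intros; apply H2; lia. }
    set (c := (1 + mu n) / 2); set (d := (1 - mu n) / 2).
    assert (Hn := proj1 (Rabs_le_between _ _) (H1 n)).
    replace (lcomb N (fun k => mu k * a k) x) with
      (madd (mscal c (lcomb N (fun k => r 1 k * a k) x))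
            (mscal d (lcomb N (fun k => r (-1) k * a k) x))).
    + eapply Rle_trans; [apply (lm_add _ _ L); apply X_sc; trivial; now apply X_lc|].
      rewrite !(fun c y h => proj2 (lm_scal _ _ L c y h)) by now apply X_lc.
      rewrite !Rabs_pos_eq by (unfold c, d; lra).
      assert (B1 := B 1 (or_introl eq_refl)); assert (B2 := B (-1) (or_intror eq_refl)).
      apply (Rmult_le_compat_l c) in B1; [|unfold c; lra].
      apply (Rmult_le_compat_l d) in B2; [|unfold d; lra].
      replace (K * nrm (lcomb N a x)) with
        (c * (K * nrm (lcomb N a x)) + d * (K * nrm (lcomb N a x)))
        by (unfold c, d; field).
      lra.
    + extensionality i; extensionality j; unfold madd, mscal, lcomb.
      rewrite <- !fsum_scal, <- fsum_plus; apply fsum_ext; intros k _; unfold r, c, d.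
      destruct (Nat.eqb_spec k n); [subst; field|field]. }
intros H.
(* Coefficients from [N] on do not enter and may be set to the sign [1], as [P] requires. *)
rewrite (lcomb_ext N _ (fun k => (if Nat.ltb k N then mu k else 1) * a k)).
- apply (P N); intros k; destruct (Nat.ltb_spec k N); auto; [rewrite Rabs_R1; lra|lia].
- intros k Hk; destruct (Nat.ltb_spec k N); [reflexivity|lia].
Qed.

Lemma coef_spec (y : mat) : X y -> expands nrm x y (co y).
Proof.
intros Hy; destruct (proj2 Hb y Hy) as [a [Ha _]].
unfold co, coef; apply epsilon_spec; now exists a.
Qed.

Lemma coef_unique (y : mat) (b : nat -> R) : X y -> expands nrm x y b -> co y = b.
Proof.
intros Hy E; destruct (proj2 Hb y Hy) as [a [_ Ha]]; extensionality n.
now rewrite (Ha b E n), (Ha _ (coef_spec y Hy) n).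
Qed.

Lemma coef_madd (y z : mat) : X y -> X z -> co (madd y z) = fun k => co y k + co z k.
Proof.
intros Hy Hz; apply coef_unique; [now apply X_ad|].
assert (Ey := coef_spec y Hy); assert (Ez := coef_spec z Hz); unfold expands in *.
apply (is_lim_seq_le_le (fun _ => 0) _
  (fun N => nrm (msub y (lcomb N (co y) x)) + nrm (msub z (lcomb N (co z) x)))).
- intros N.
  assert (HN : forall y, X y -> X (msub y (lcomb N (co y) x)))
    by (intros; apply X_sb; trivial; now apply X_lc).
  replace (msub (madd y z) (lcomb N (fun k => co y k + co z k) x)) with
    (madd (msub y (lcomb N (co y) x)) (msub z (lcomb N (co z) x))).
  + split; [apply nrm_nonneg with X; trivial; now apply X_ad; auto|].
    apply (lm_add _ _ L); auto.
  + extensionality i; extensionality j; unfold madd, msub, lcomb.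
    rewrite (fsum_ext N (fun k => (co y k + co z k) * x k i j)
      (fun k => co y k * x k i j + co z k * x k i j)) by (intros; ring).
    rewrite fsum_plus; ring.
- apply is_lim_seq_const.
- replace (Finite 0) with (Finite (0 + 0)) by (f_equal; ring); now apply is_lim_seq_plus'.
Qed.

Lemma coef_mscal (c : R) (y : mat) : X y -> co (mscal c y) = fun k => c * co y k.
Proof.
intros Hy; apply coef_unique; [now apply X_sc|].
assert (Ey := coef_spec y Hy); unfold expands in *.
apply is_lim_seq_ext with (fun N => Rabs c * nrm (msub y (lcomb N (co y) x))).
- intros N; rewrite <- (proj2 (lm_scal _ _ L c (msub y (lcomb N (co y) x))
    (X_sb _ _ Hy (X_lc N _)))); f_equal.
  extensionality i; extensionality j; unfold mscal, msub, lcomb.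
  rewrite (fsum_ext N (fun k => c * co y k * x k i j) (fun k => c * (co y k * x k i j)))
    by (intros; ring).
  rewrite fsum_scal; ring.
- replace (Finite 0) with (Rbar_mult (Rabs c) 0) by (simpl; f_equal; ring).
  now apply is_lim_seq_scal_l.
Qed.

Lemma coef_lcomb (N : nat) (a : nat -> R) :
  co (lcomb N a x) = fun k => if Nat.ltb k N then a k else 0.
Proof.
apply coef_unique; [now apply X_lc|].
apply (is_lim_seq_ext_loc (fun _ => 0)); [|apply is_lim_seq_const].
exists N; intros n Hn; rewrite (lcomb_extend N n _ x Hn) by
  (intros k Hk; destruct (Nat.ltb_spec k N); [lia|reflexivity]).
rewrite (lcomb_ext N (fun k => if Nat.ltb k N then a k else 0) a).
- symmetry; etransitivity; [|apply (nrm_0 X nrm L)]; f_equal; extensionality i; extensionality j; unfold msub; ring.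
- intros k Hk; destruct (Nat.ltb_spec k N); [reflexivity|lia].
Qed.

Lemma coef_basis (n k : nat) : co (x n) k = if Nat.eqb k n then 1 else 0.
Proof.
replace (x n) with (lcomb (S n) (fun k => if Nat.eqb k n then 1 else 0) x).
- rewrite coef_lcomb; destruct (Nat.ltb_spec k (S n)), (Nat.eqb_spec k n); trivial; lia.
- extensionality i; extensionality j; unfold lcomb.
  rewrite (fsum_single _ n); [rewrite Nat.eqb_refl; ring|lia|].
  intros l _ Hl; destruct (Nat.eqb_spec l n); [easy|ring].
Qed.

Lemma coef_msum (N : nat) (w : nat -> mat) (k : nat) : (forall j, X (w j)) ->
  co (msum N w) k = fsum N (fun j => co (w j) k).
Proof.
intros Hw; induction N as [|N IH]; simpl.
- rewrite (coef_unique _ (fun _ => 0)); trivial; [now apply X_ms|].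
  apply (is_lim_seq_ext (fun _ => 0)); [|apply is_lim_seq_const].
  intros n; symmetry; etransitivity; [|apply (nrm_0 X nrm L)]; f_equal.
  extensionality i; extensionality j; unfold msub, msum, lcomb; simpl.
  rewrite fsum_0 by (intros; ring); ring.
- change (msum (S N) w) with (madd (msum N w) (w N)).
  rewrite coef_madd; trivial; [now rewrite IH|now apply X_ms].
Qed.

(** A diagonal operator with respect to the basis, cut off at [N]: finite rank keeps all sums
    finite, while the bounds below do not depend on [N]. *)
Definition multiplier (N : nat) (mu : nat -> R) (y : mat) : mat :=
  lcomb N (fun k => mu k * co y k) x.

Lemma X_multiplier (N : nat) (mu : nat -> R) (y : mat) : X (multiplier N mu y).
Proof. now apply X_lc. Qed.

(** The finite inequality passes to [y] through a partial sum of length [P >= N] within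
    [eps / (B * K)] of [y]; extending the multiplier by [0] beyond [N] makes it act on that partial
    sum as on [y]. *)
Lemma multiplier_bound (N : nat) (mu : nat -> R) (B : R) (y : mat) : X y -> 0 < B ->
  (forall k, Rabs (mu k) <= B) -> nrm (multiplier N mu y) <= B * K * nrm y.
Proof.
intros Hy HB Hmu.
set (nu := fun k => if Nat.ltb k N then / B * mu k else 0).
assert (Hnu : forall k, Rabs (nu k) <= 1).
{ intros k; unfold nu; destruct (Nat.ltb k N); [|rewrite Rabs_R0; lra].
  rewrite Rabs_mult, Rabs_pos_eq by (left; now apply Rinv_0_lt_compat).
  apply Rmult_le_reg_l with B; trivial; rewrite <- Rmult_assoc, Rinv_r by lra.
  specialize (Hmu k); lra. }
assert (E := coef_spec y Hy); unfold expands in E.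
apply Rle_plus_epsilon; intros eps He.
destruct (proj1 (lim0_spec _) E (eps / (B * K))) as [N' HN'].
{ apply Rdiv_lt_0_compat; trivial; nra. }
specialize (HN' (N' + N)%nat ltac:(lia)); set (P := (N' + N)%nat) in *.
assert (HP : X (lcomb P (co y) x)) by now apply X_lc.
replace (multiplier N mu y) with (mscal B (lcomb P (fun k => nu k * co y k) x)).
- rewrite (proj2 (lm_scal _ _ L B _ (X_lc P _))), Rabs_pos_eq by lra.
  assert (H1 := multiplier_finite P (co y) nu Hnu).
  assert (H2 : nrm (lcomb P (co y) x) <= nrm y + nrm (msub y (lcomb P (co y) x))).
  { replace (lcomb P (co y) x) with (msub y (msub y (lcomb P (co y) x))) at 1.
    - apply (nrm_sub X); trivial; now apply X_sb.
    - extensionality i; extensionality j; unfold msub; ring. }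
  assert (H0 := Rle_abs (nrm (msub y (lcomb P (co y) x)))).
  assert (H3 : nrm (lcomb P (co y) x) <= nrm y + eps / (B * K)) by lra.
  apply (Rmult_le_compat_l K) in H3; [|lra].
  apply Rle_trans with (B * (K * (nrm y + eps / (B * K)))).
  + apply Rmult_le_compat_l; lra.
  + right; field; split; lra.
- rewrite (lcomb_extend N P).
  + extensionality i; extensionality j; unfold mscal, multiplier, lcomb.
    rewrite <- fsum_scal; apply fsum_ext; intros k Hk; unfold nu.
    destruct (Nat.ltb_spec k N); [field; lra|lia].
  + unfold P; lia.
  + intros k Hk; unfold nu; destruct (Nat.ltb_spec k N); [lia|ring].
Qed.

(** The multiplier that keeps only the [n]-th coefficient has norm at most [K], and [x n] has norm
    at least [m]. *)
Lemma coef_bound (y : mat) (n : nat) : X y -> Rabs (co y n) <= K / m * nrm y.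
Proof.
intros Hy.
assert (H := multiplier_bound (S n) (fun k => if Nat.eqb k n then 1 else 0) 1 y Hy Rlt_0_1).
replace (multiplier (S n) _ y) with (mscal (co y n) (x n)) in H.
- rewrite (proj2 (lm_scal _ _ L _ _ (Xx n))) in H.
  apply Rmult_le_reg_r with m; trivial.
  replace (K / m * nrm y * m) with (1 * K * nrm y) by (field; lra).
  eapply Rle_trans; [|apply H].
  + apply Rmult_le_compat_l; [apply Rabs_pos|apply Hx].
  + intros k; destruct (Nat.eqb k n); rewrite ?Rabs_R1, ?Rabs_R0; lra.
- extensionality i; extensionality j; unfold mscal, multiplier, lcomb.
  rewrite (fsum_single _ n); [rewrite Nat.eqb_refl; ring|lia|].
  intros l _ Hl; destruct (Nat.eqb_spec l n); [easy|ring].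
Qed.

(** Consecutive partial sums of the expansion differ by [co y n] times [x n], whose norm is at least
    [m]. *)
Lemma coef_lim (y : mat) : X y -> is_lim_seq (co y) 0.
Proof.
intros Hy; assert (E := coef_spec y Hy); unfold expands in E.
apply is_lim_seq_abs_0.
apply (is_lim_seq_le_le (fun _ => 0) _ (fun n => / m *
  (nrm (msub y (lcomb n (co y) x)) + nrm (msub y (lcomb (S n) (co y) x))))).
- intros n; split; [apply Rabs_pos|].
  apply Rmult_le_reg_l with m; trivial.
  rewrite <- Rmult_assoc, Rinv_r, Rmult_1_l by lra.
  assert (HX : forall n, X (lcomb n (co y) x)) by (intros; now apply X_lc).
  rewrite (nrm_sub_sym X nrm L y (lcomb (S n) (co y) x)), Rplus_comm by auto.
  eapply Rle_trans; [|apply (nrm_triangle X nrm L); auto].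
  replace (msub (lcomb (S n) (co y) x) (lcomb n (co y) x)) with (mscal (co y n) (x n)).
  + rewrite (proj2 (lm_scal _ _ L _ _ (Xx n))), Rmult_comm.
    apply Rmult_le_compat_l; [apply Rabs_pos|apply Hx].
  + extensionality i; extensionality j; unfold mscal, msub, lcomb; simpl; ring.
- apply is_lim_seq_const.
- replace (Finite 0) with (Rbar_mult (/ m) 0) by (simpl; f_equal; ring).
  apply is_lim_seq_scal_l.
  replace (Finite 0) with (Finite (0 + 0)) by (f_equal; ring).
  apply is_lim_seq_plus'; trivial; now apply is_lim_seq_incr_1 in E.
Qed.

Lemma coef_value (y : mat) (i j : nat) : X y ->
  is_lim_seq (fun N => y i j - fsum N (fun k => co y k * x k i j)) 0.
Proof.
intros Hy; assert (E := coef_spec y Hy); unfold expands in E.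
apply is_lim_seq_abs_0.
apply (is_lim_seq_le_le (fun _ => 0) _ (fun N => nrm (msub y (lcomb N (co y) x)))); trivial.
- intros N; split; [apply Rabs_pos|].
  apply (lm_coord _ _ L (msub y (lcomb N (co y) x)) i j).
  apply X_sb; trivial; now apply X_lc.
- apply is_lim_seq_const.
Qed.

Lemma multiplier_extend (N N' : nat) (mu : nat -> R) (y : mat) : (N <= N')%nat ->
  (forall k, (N <= k)%nat -> mu k = 0) -> multiplier N' mu y = multiplier N mu y.
Proof.
intros H Hmu; apply lcomb_extend; trivial; intros k Hk; rewrite Hmu by trivial; ring.
Qed.

Lemma multiplier_mscal (N : nat) (mu : nat -> R) (c : R) (y : mat) : X y ->
  multiplier N mu (mscal c y) = mscal c (multiplier N mu y).
Proof.
intros Hy; unfold multiplier; rewrite coef_mscal by trivial.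
extensionality i; extensionality j; unfold mscal, lcomb.
rewrite <- fsum_scal; apply fsum_ext; intros; ring.
Qed.

Lemma multiplier_scal_l (N : nat) (mu : nat -> R) (c : R) (y : mat) :
  multiplier N (fun k => c * mu k) y = mscal c (multiplier N mu y).
Proof.
extensionality i; extensionality j; unfold mscal, multiplier, lcomb.
rewrite <- fsum_scal; apply fsum_ext; intros; ring.
Qed.

(** The counterpart of [proj_diag] with the roles exchanged: the multipliers [mu j] live on the
    disjoint index sets [S j], so with signs they merge into one multiplier [Th], which is bounded
    because the basis is unconditional. *)
Lemma multiplier_diag (N P : nat) (S : nat -> nat -> bool) (J : nat -> nat * nat -> bool)
  (mu : nat -> nat -> R) (v : nat -> mat) (B : R) :
  disjoint_family S -> disjoint_family J -> (forall j, X (v j)) ->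
  (forall j, proj (J j) (v j) = v j) -> 0 < B -> (forall j k, Rabs (mu j k) <= B) ->
  (forall j k, S j k = false -> mu j k = 0) ->
  nrm (msum N (fun j => multiplier P (mu j) (v j))) <= B * K * nrm (msum N v).
Proof.
intros HS HJ Hv Hp HB Hmu Hz.
apply (nrm_diag X nrm L N (fun a b => multiplier P (mu a) (v b)));
  [intros; apply X_multiplier|].
intros th Hth.
set (W := msum N (fun k => mscal (th k) (v k))).
assert (HW : X W) by (apply X_ms; trivial; intros; now apply X_sc).
set (Th := fun k => select N (fun a => th a * mu a k) S k).
assert (G : nrm (multiplier P Th W) <= B * K * nrm W).
{ apply multiplier_bound; trivial; intros k; apply select_bound; trivial; [lra|].
  intros a; rewrite Rabs_mult, signs_abs, Rmult_1_l by trivial; apply Hmu. }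
eapply Rle_trans; [|eapply Rle_trans; [exact G|]].
- right; f_equal; extensionality i; extensionality j.
  (* Both sides are triple sums over two indices of vectors and one of the basis; the sums over [a]
     and [b] then recombine into [Th k] and the coefficient of [W]. *)
  transitivity (fsum N (fun a => fsum N (fun b => fsum P (fun k =>
     th a * th b * (mu a k * co (v b) k * x k i j))))).
  { apply fsum_ext; intros a _; apply fsum_ext; intros b _; unfold mscal, multiplier, lcomb.
    now rewrite <- fsum_scal. }
  rewrite (fsum_ext N _ (fun a => fsum P (fun k => fsum N (fun b =>
     th a * th b * (mu a k * co (v b) k * x k i j))))) by (intros; apply fsum_swap).
  rewrite fsum_swap; unfold multiplier, lcomb; apply fsum_ext; intros k _.
  unfold W; rewrite coef_msum by (intros; now apply X_sc).
  transitivity (fsum N (fun a => th a * mu a k * (fsum N (fun b => th b * co (v b) k) * x k i j))).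
  + apply fsum_ext; intros a _.
    rewrite <- (Rmult_comm (x k i j)), <- Rmult_assoc, <- fsum_scal.
    apply fsum_ext; intros; ring.
  + rewrite (fsum_ext N (fun b => co (mscal (th b) (v b)) k) (fun b => th b * co (v b) k))
      by (intros; now rewrite coef_mscal).
    rewrite Rmult_assoc; set (F := _ * x k i j); rewrite (Rmult_comm (Th k)).
    unfold Th, select; rewrite <- fsum_scal; apply fsum_ext; intros a _.
    destruct (S a k) eqn:E; [ring|rewrite (Hz a k E); ring].
(* The signs inside [W] are removed at no cost, as the [v j] have disjoint supports. *)
- apply Rmult_le_compat_l; [nra|].
  rewrite <- (Rmult_1_l (nrm (msum N v))).
  apply (nrm_flip X nrm L N J); trivial; [lra|].
  intros k; rewrite signs_abs by trivial; lra.
Qed.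

(** A combination of the subsequence is a combination of the first [phi N] basis vectors with zeros
    in the gaps. The signs extend by [0] to these gaps, hence the use of [multiplier_finite]. *)
Lemma subsequence_signs (phi : nat -> nat) (N : nat) (a th : nat -> R) :
  (forall n, (phi n < phi (S n))%nat) -> signs th ->
  nrm (lcomb N (fun k => th k * a k) (fun n => x (phi n))) <=
  K * nrm (lcomb N a (fun n => x (phi n))).
Proof.
intros Hphi Hth.
set (D := fun j k => Nat.eqb k (phi j)).
assert (HD : disjoint_family D).
{ intros i j k Hi Hj; apply Nat.eqb_eq in Hi, Hj; subst k.
  assert (H := increasing_lt phi Hphi).
  destruct (Nat.lt_trichotomy i j) as [l|[e|l]]; trivial; specialize (H _ _ l); lia. }
assert (E : forall b, lcomb N b (fun n => x (phi n)) = lcomb (phi N) (select N b D) x).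
{ intros b; extensionality i; extensionality j; unfold lcomb.
  rewrite (fsum_ext (phi N) _ (fun k => fsum N (fun l => if D l k then b l * x k i j else 0))).
  - rewrite fsum_swap; apply fsum_ext; intros l Hl.
    rewrite (fsum_single _ (phi l)).
    + unfold D; now rewrite Nat.eqb_refl.
    + now apply increasing_lt.
    + intros k _ Hk; unfold D; now destruct (Nat.eqb_spec k (phi l)).
  - intros k _; rewrite Rmult_comm; unfold select; rewrite <- fsum_scal.
    apply fsum_ext; intros l _; destruct (D l k); ring. }
rewrite !E.
rewrite (lcomb_ext (phi N) _ (fun k => select N th D k * select N a D k)).
- apply multiplier_finite; intros k; apply select_bound; trivial; [lra|].
  intros l; rewrite signs_abs by trivial; lra.
- intros k _.
  destruct (classic (exists j, (j < N)%nat /\ D j k = true)) as [[j [Hj Ej]]|H].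
  + now rewrite !(select_in N _ D k j).
  + assert (Z : forall b, select N b D k = 0).
    { intros b; apply fsum_0; intros l Hl; destruct (D l k) eqn:F; trivial.
      elim H; now exists l. }
    rewrite !Z; ring.
Qed.

(** * Densities and the two selections of subsequences *)

Definition density (T : nat -> nat * nat -> bool) (t n : nat) : R := co (proj (T t) (x n)) n.

Lemma region_small (T : nat -> nat * nat -> bool) (y : mat) (s : nat) (eps : R) :
  region X nrm T -> X y -> 0 < eps -> exists t, (s <= t)%nat /\ nrm (proj (T t) y) < eps.
Proof.
intros HT Hy He; destruct (region_tail _ _ _ HT y eps Hy He) as [t Ht].
exists (Nat.max s t); split; [lia|]; apply Rle_lt_trans with (2 := Ht).
apply (lm_lat _ _ L); [now apply X_pr|].
intros i j; unfold proj.
assert (H := region_mono _ _ _ HT t (Nat.max s t) (i, j) ltac:(lia)).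
destruct (T (Nat.max s t) (i, j)); [rewrite H; trivial; lra|].
rewrite Rabs_R0; apply Rabs_pos.
Qed.

Lemma K_m_pos : 0 < K / m.
Proof. apply Rdiv_lt_0_compat; lra. Qed.

(* The biorthogonal functionals see the shells [proj J_j (x_{phi j})] diagonally, so averaging
   over signs makes the subsequence and the sequence of shells dominate each other. *)
Lemma dense_subsequence (T : nat -> nat * nat -> bool) : region X nrm T ->
  (forall t n0, exists n, (n0 <= n)%nat /\ 1 / 4 <= Rabs (density T t n)) ->
  exists (phi : nat -> nat) (v : nat -> mat), (forall n, (phi n < phi (S n))%nat) /\
    blocks X nrm T v /\ equivalent nrm (fun n => x (phi n)) v.
Proof.
intros HT HD.
pose (Rel := fun a b : nat * (nat * nat) =>
  let '(n, (s, t)) := a in let '(n', (s', t')) := b in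
  (n < n')%nat /\ (t <= s' <= t')%nat /\
  1 / 8 <= Rabs (co (proj (shell T s' t') (x n')) n')).
destruct (dependent_choice Rel (0, (0, 0))%nat) as [f Hf].
{ intros [n [s t]]; destruct (HD t (S n)) as [n' [Hn Hd]].
  (* The part of [x n'] in [T t'] has [n']-th coefficient below [1/8], so the shell keeps at least
     [1/4 - 1/8]. *)
  destruct (region_small T (x n') t (/ (K / m) * (1 / 8)) HT (Xx n')) as [t' [Ht Hs]].
  { apply Rmult_lt_0_compat; [apply Rinv_0_lt_compat, K_m_pos|lra]. }
  exists (n', (t, t')); split; [lia|split; [lia|]].
  rewrite (proj_shell X nrm T t t' _ HT Ht).
  rewrite coef_madd, coef_mscal by (try apply X_sc; now apply X_pr).
  assert (H := coef_bound (proj (T t') (x n')) n' (X_pr _ _ (Xx n'))).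
  assert (HKm := K_m_pos).
  apply (Rmult_lt_compat_l (K / m)) in Hs; trivial.
  rewrite <- Rmult_assoc, Rinv_r, Rmult_1_l in Hs by lra.
  unfold density in Hd.
  revert Hd H; unfold Rabs; repeat destruct Rcase_abs; lra. }
(* The index [S j] skips the arbitrary starting value, about which [Rel] asserts nothing. *)
set (phi := fun j => fst (f (S j))).
set (s := fun j => fst (snd (f (S j)))); set (t := fun j => snd (snd (f (S j)))).
assert (Hphi : forall j, (phi j < phi (S j))%nat).
{ intros j; specialize (Hf (S j)); unfold phi.
  destruct (f (S j)) as [n [s1 t1]], (f (S (S j))) as [n' [s' t']]; simpl in *; tauto. }
assert (Hst : forall j, (s j <= t j <= s (S j))%nat).
{ intros j; assert (H1 := Hf j); assert (H2 := Hf (S j)); unfold s, t.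
  destruct (f j) as [n0 [s0 t0]], (f (S j)) as [n [s1 t1]], (f (S (S j))) as [n' [s' t']].
  simpl in *; lia. }
set (J := fun j => shell T (s j) (t j)).
set (v := fun j => proj (J j) (x (phi j))).
assert (Hc : forall j, 1 / 8 <= Rabs (co (v j) (phi j))).
{ intros j; assert (H1 := Hf j); unfold v, J, s, t, phi.
  destruct (f j) as [n0 [s0 t0]], (f (S j)) as [n [s1 t1]]; simpl in *; tauto. }
clearbody phi s t; clear f Hf.
assert (HJ : disjoint_family J) by now apply (shell_disjoint X nrm).
assert (Hv : forall j, X (v j)) by (intros; now apply X_pr).
exists phi, v; split; [trivial|split].
- exists s, t, (/ (K / m) * (1 / 8)), M; split.
  { apply Rmult_lt_0_compat; [apply Rinv_0_lt_compat, K_m_pos|lra]. }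
  intros j; split; [apply Hst|split; [apply Hv|split; [apply proj_idem|split]]].
  + apply Rmult_le_reg_l with (K / m); [apply K_m_pos|].
    rewrite <- Rmult_assoc, Rinv_r, Rmult_1_l by (apply Rgt_not_eq, K_m_pos).
    eapply Rle_trans; [apply Hc|now apply coef_bound].
  + eapply Rle_trans; [now apply (nrm_proj X nrm L)|apply Hx].
- exists (8 * K); split; [lra|]; intros N a; split.
  (* This multiplier picks the coefficient of [v j] at [phi j] and normalizes it, so that it sends
     [v j] to [x (phi j)]. Its entries are at most [8], the inverse of [1/8]. *)
  + set (mu := fun j k => if Nat.eqb k (phi j) then / co (v j) (phi j) else 0).
    replace (lcomb N a (fun n => x (phi n))) with
      (msum N (fun j => multiplier (phi N) (mu j) (mscal (a j) (v j)))).
    * apply (multiplier_diag N (phi N) (fun j k => Nat.eqb k (phi j)) J); trivial.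
      -- intros i j k Hi Hj; apply Nat.eqb_eq in Hi, Hj; subst k.
         assert (H := increasing_lt phi Hphi).
         destruct (Nat.lt_trichotomy i j) as [l|[e|l]]; trivial; specialize (H _ _ l); lia.
      -- intros; now apply X_sc.
      -- intros j; rewrite proj_mscal; f_equal; apply proj_idem.
      -- lra.
      -- intros j k; unfold mu; destruct (Nat.eqb k (phi j)); [|rewrite Rabs_R0; lra].
         rewrite Rabs_inv; specialize (Hc j).
         replace 8 with (/ (1 / 8)) by field; apply Rinv_le_contravar; lra.
      -- intros j k H; unfold mu; now rewrite H.
    * extensionality p; extensionality q; apply fsum_ext; intros j Hj.
      rewrite multiplier_mscal by trivial; unfold mscal; f_equal.
      unfold multiplier, lcomb; rewrite (fsum_single _ (phi j)).
      -- unfold mu; rewrite Nat.eqb_refl, Rinv_l, Rmult_1_l; trivial.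
         specialize (Hc j); intros E; rewrite E, Rabs_R0 in Hc; lra.
      -- now apply increasing_lt.
      -- intros k _ Hk; unfold mu; destruct (Nat.eqb_spec k (phi j)); [easy|ring].
  + replace (lcomb N a v) with (msum N (fun j => proj (J j) (mscal (a j) (x (phi j))))).
    * apply (proj_diag X nrm L); trivial; [intros; now apply X_sc|].
      intros th Hth; eapply Rle_trans; [|eapply Rle_trans;
        [apply (subsequence_signs phi N a th Hphi Hth)|]].
      -- right; f_equal; extensionality p; extensionality q; apply fsum_ext.
         intros; unfold mscal; ring.
      -- apply Rmult_le_compat_r; [|lra]; apply (nrm_nonneg X nrm L).
         now apply (X_lcomb X nrm L).
    * extensionality p; extensionality q; apply fsum_ext; intros j _.
      now rewrite proj_mscal.
Qed.

Lemma lim0_finite_sum (N : nat) (g : nat -> nat -> R) :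
  (forall n, is_lim_seq (fun i => g n i) 0) ->
  is_lim_seq (fun i => fsum N (fun n => Rabs (g n i))) 0.
Proof.
intros H; induction N as [|N IH]; simpl; [apply is_lim_seq_const|].
replace (Finite 0) with (Finite (0 + 0)) by (f_equal; ring).
apply is_lim_seq_plus'; trivial; now apply -> is_lim_seq_abs_0.
Qed.

Lemma fsum_split (N P : nat) (f : nat -> R) : (N <= P)%nat ->
  fsum P f = fsum N f + fsum P (fun k => if Nat.leb N k then f k else 0).
Proof.
induction 1 as [|P HP IH]; simpl.
- rewrite (fsum_0 N (fun k => if Nat.leb N k then f k else 0)); [ring|].
  intros k Hk; destruct (Nat.leb_spec N k); [lia|reflexivity].
- rewrite IH; destruct (Nat.leb_spec N P); [ring|lia].
Qed.

(** Exhibits the entry as a double sum in which signs put on [nu] and on [mu] appear as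
    [th n * th k], the form needed for [diag_extraction]. *)
Lemma multiplier_proj_value (b : nat) (nu mu : nat -> R) (J : nat * nat -> bool) (y : mat)
  (p q : nat) :
  multiplier b nu (proj J (multiplier b mu y)) p q =
  fsum b (fun n => fsum b (fun k =>
    nu n * mu k * (co (proj J (x k)) n * co y k * x n p q))).
Proof.
assert (E : proj J (multiplier b mu y) =
  msum b (fun k => mscal (mu k * co y k) (proj J (x k)))).
{ extensionality i; extensionality j; unfold proj, multiplier, lcomb, msum, mscal.
  destruct (J (i, j)); [reflexivity|]; rewrite fsum_0; trivial; intros; ring. }
rewrite E; unfold multiplier, lcomb; apply fsum_ext; intros n _.
rewrite coef_msum by (intros; apply X_sc; now apply X_pr).
rewrite Rmult_comm, <- Rmult_assoc, <- fsum_scal; apply fsum_ext; intros k _.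
rewrite coef_mscal by (now apply X_pr); ring.
Qed.

(** [mu] leads from a unit matrix to a block of basis vectors, which is restricted to a shell, and
    [nu] leads back; [step_val] says that the round trip keeps a quarter of the entry. Both vanish
    off [[a, b)], so successive steps use different basis vectors. The bound [4] is the inverse of
    the least density [1/4]. *)
Record step (T : nat -> nat * nat -> bool) (y : nat -> mat) (p q : nat -> nat)
  (a b i s t : nat) (mu nu : nat -> R) : Prop := {
  step_ab : (a <= b)%nat;
  step_st : (s <= t)%nat;
  step_mu : forall k, Rabs (mu k) <= 4;
  step_nu : forall k, Rabs (nu k) <= 1;
  step_out : forall k, (Nat.leb a k && Nat.ltb k b)%bool = false -> mu k = 0 /\ nu k = 0;
  step_val : 1 / 4 <= multiplier b nu (proj (shell T s t) (multiplier b mu (y i))) (p i) (q i) }.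

(* With [I = [a, b)] and [m_n = 1 / density n], averaging
   [P_I eps R_{T s} eps m P_I y_i] over all signs [eps] gives [P_I y_i], whose entry at [(p i, q i)]
   is at least [1/2]; some choice of signs does at least as well. *)
Lemma step_exists (T : nat -> nat * nat -> bool) (p q : nat -> nat) (a0 i0 s : nat) :
  region X nrm T ->
  (forall t, exists n0, forall n, (n0 <= n)%nat -> 1 / 4 <= density T t n) ->
  (forall y, X y -> is_lim_seq (fun i => y (p i) (q i)) 0) ->
  exists a b i t mu nu, (a0 <= a)%nat /\ (i0 < i)%nat /\
    step T (fun i => unit_mat (p i) (q i)) p q a b i s t mu nu.
Proof.
intros HT HD Hpq.
destruct (HD s) as [n0 Hn0]; set (a := Nat.max a0 n0).
assert (Kp := K_m_pos).
(* The order of choice is [a], then [i], then [b]: beyond [a] the densities are large, [i] makes the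
   entries at [(p i, q i)] of the first [a] basis vectors small, and [b] depends on the expansion of
   the unit matrix. *)
destruct (proj1 (lim0_spec _) (lim0_finite_sum a (fun n i => x n (p i) (q i))
   (fun n => Hpq _ (Xx n))) (/ (K / m) * (1 / 4))) as [i1 Hi1].
{ apply Rmult_lt_0_compat; [now apply Rinv_0_lt_compat|lra]. }
set (i := Nat.max (S i0) i1); specialize (Hi1 i ltac:(lia)).
set (y := unit_mat (p i) (q i)).
destruct (lm_unit _ _ L (p i) (q i)) as [Xy Ny]; fold y in Xy, Ny.
destruct (proj1 (lim0_spec _) (coef_value y (p i) (q i) Xy) (1 / 4)) as [b1 Hb1]; [lra|].
set (b := Nat.max a b1); specialize (Hb1 b ltac:(lia)).
set (I := fun k => (Nat.leb a k && Nat.ltb k b)%bool).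
(* From the entry [1] of [y], at most [1/4] is lost below [a] and at most [1/4] beyond [b]. *)
assert (Hsum : 1 / 2 <= fsum b (fun k => if I k then co y k * x k (p i) (q i) else 0)).
{ rewrite (fsum_split a b) in Hb1 by lia.
  rewrite (fsum_ext b (fun k => if I k then _ else 0)
    (fun k => if Nat.leb a k then co y k * x k (p i) (q i) else 0)).
  2: { intros k Hk; unfold I; destruct (Nat.ltb_spec k b); [|lia].
       now rewrite Bool.andb_true_r. }
  assert (H1 : Rabs (fsum a (fun k => co y k * x k (p i) (q i))) <= 1 / 4).
  { eapply Rle_trans; [apply fsum_abs|].
    eapply Rle_trans; [apply (fsum_le a _ (fun k => (K / m) * Rabs (x k (p i) (q i))))|].
    - intros k _; rewrite Rabs_mult; apply Rmult_le_compat_r; [apply Rabs_pos|].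
      rewrite <- (Rmult_1_r (K / m)), <- Ny; now apply coef_bound.
    - rewrite fsum_scal; apply Rmult_le_reg_l with (/ (K / m)); [now apply Rinv_0_lt_compat|].
      rewrite <- Rmult_assoc, Rinv_l, Rmult_1_l by lra.
      left; eapply Rle_lt_trans; [apply Rle_abs|exact Hi1]. }
  assert (H2 : y (p i) (q i) = 1) by (unfold y, unit_mat; now rewrite !Nat.eqb_refl).
  rewrite H2 in Hb1; apply Rabs_def2 in Hb1; apply Rabs_le_between in H1; lra. }
set (mu0 := fun k => if I k then / density T s k else 0).
set (nu0 := fun k => if I k then 1 else 0).
assert (Hd : forall k, I k = true -> 1 / 4 <= density T s k).
{ intros k Hk; apply Bool.andb_true_iff in Hk; destruct Hk as [Hk _].
  apply Nat.leb_le in Hk; apply Hn0; lia. }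
assert (Hth : exists th, signs th /\ 1 / 2 <= multiplier b (fun k => th k * nu0 k)
   (proj (T s) (multiplier b (fun k => th k * mu0 k) y)) (p i) (q i)).
{ apply NNPP; intros C.
  (* Scalars are encoded as constant matrices and read off at one entry. If every choice of signs
     stayed below [1/2], so would the diagonal, where [mu0] cancels the densities and leaves the sum
     in [Hsum]. *)
  assert (G := diag_extraction (fun z => z 0%nat 0%nat < 1 / 2)
    (fun z w (Hz : z 0%nat 0%nat < 1 / 2) (Hw : w 0%nat 0%nat < 1 / 2) => ltac:(lra))
    b (fun n k _ _ => nu0 n * mu0 k * (co (proj (T s) (x k)) n * co y k * x n (p i) (q i)))
    (fun _ _ => 0)); cbv beta in G.
  assert (G2 : 0 + fsum b (fun n => nu0 n * mu0 n *
      (co (proj (T s) (x n)) n * co y n * x n (p i) (q i))) < 1 / 2).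
  { apply G; intros th Hth; apply Rnot_le_lt; intros C2; apply C; exists th; split; trivial.
    rewrite multiplier_proj_value, Rplus_0_l in *.
    eapply Rle_trans; [exact C2|right].
    apply fsum_ext; intros n _; apply fsum_ext; intros k _; ring. }
  rewrite Rplus_0_l, (fsum_ext b _ (fun k => if I k then co y k * x k (p i) (q i) else 0)) in G2;
    [lra|].
  intros k _; unfold nu0, mu0; destruct (I k) eqn:E; [|ring].
  specialize (Hd k E); fold (density T s k); field; lra. }
destruct Hth as [th [Sth Hth]].
set (nu := fun k => th k * nu0 k) in *; set (mu := fun k => th k * mu0 k) in *.
assert (Hnu : forall k, Rabs (nu k) <= 1).
{ intros k; unfold nu, nu0; rewrite Rabs_mult, signs_abs by trivial.
  destruct (I k); rewrite ?Rabs_R1, ?Rabs_R0; lra. }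
(* Cutting off [T t] costs at most [K] times this norm, that is [1/4], and leaves [1/2 - 1/4]. *)
destruct (region_small T (multiplier b mu y) s (/ K * (1 / 4)) HT (X_multiplier _ _ _))
  as [t [Ht Hs]].
{ apply Rmult_lt_0_compat; [apply Rinv_0_lt_compat|]; lra. }
exists a, b, i, t, mu, nu; split; [lia|split; [lia|]].
split; trivial; [lia| | |].
- intros k; unfold mu, mu0; rewrite Rabs_mult, signs_abs, Rmult_1_l by trivial.
  destruct (I k) eqn:E; [|rewrite Rabs_R0; lra].
  specialize (Hd k E); rewrite Rabs_inv, Rabs_pos_eq by lra.
  replace 4 with (/ (1 / 4)) by field; apply Rinv_le_contravar; lra.
- intros k Hk; unfold mu, nu, mu0, nu0; fold (I k) in Hk; rewrite Hk; split; ring.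
- fold y; rewrite (proj_shell X nrm T s t _ HT Ht).
  set (w := multiplier b mu y) in *.
  assert (Xw : forall t, X (proj (T t) w)) by (intros; apply X_pr, X_multiplier).
  assert (B : Rabs (multiplier b nu (proj (T t) w) (p i) (q i)) <= 1 / 4).
  { eapply Rle_trans; [apply (lm_coord _ _ L); apply X_multiplier|].
    eapply Rle_trans; [apply (multiplier_bound b nu 1); trivial; lra|].
    apply (Rmult_lt_compat_l K) in Hs; [|lra].
    rewrite <- Rmult_assoc, Rinv_r in Hs by lra; lra. }
  assert (E : multiplier b nu (madd (proj (T s) w) (mscal (-1) (proj (T t) w))) (p i) (q i) =
    multiplier b nu (proj (T s) w) (p i) (q i) - multiplier b nu (proj (T t) w) (p i) (q i)).
  { unfold multiplier, lcomb; rewrite coef_madd, coef_mscal by (try apply X_sc; trivial).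
    unfold Rminus; rewrite <- (Rmult_1_l (fsum b (fun k => nu k * co (proj (T t) w) k * _))).
    rewrite <- Ropp_mult_distr_l_reverse, <- fsum_scal, <- fsum_plus.
    apply fsum_ext; intros; ring. }
  rewrite E; apply Rabs_le_between in B; lra.
Qed.

(** Each unit matrix [Y (phi j)] travels to [w j] by [mu j], to [v j] by restriction to a shell, to
    [z j] by [nu j], and back by restriction to its own position. The shells, the intervals of basis
    indices and the positions are all disjoint, so every stage is bounded on whole sums by diagonal
    extraction. *)
Lemma codense_subsequence (T : nat -> nat * nat -> bool) (p q : nat -> nat) :
  region X nrm T ->
  (forall t, exists n0, forall n, (n0 <= n)%nat -> 1 / 4 <= density T t n) ->
  (forall i j, p i = p j -> q i = q j -> i = j) ->
  (forall y, X y -> is_lim_seq (fun i => y (p i) (q i)) 0) ->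
  exists (phi : nat -> nat) (v : nat -> mat), (forall n, (phi n < phi (S n))%nat) /\
    blocks X nrm T v /\ equivalent nrm (fun n => unit_mat (p (phi n)) (q (phi n))) v.
Proof.
intros HT HD Hinj Hpq.
set (Y := fun i => unit_mat (p i) (q i)).
assert (XY : forall i, X (Y i)) by (intros; apply (lm_unit _ _ L)).
pose (Rel := fun u u' : (nat * nat * nat) * (nat * nat) * ((nat -> R) * (nat -> R)) =>
  let '((a, b, i), (s, t), (mu, nu)) := u in
  let '((a', b', i'), (s', t'), (mu', nu')) := u' in
  (b <= a')%nat /\ (i < i')%nat /\ (t <= s')%nat /\ step T Y p q a' b' i' s' t' mu' nu').
destruct (dependent_choice Rel ((0, 0, 0)%nat, (0, 0)%nat, (fun _ => 0, fun _ => 0))) as [f Hf].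
{ intros [[[[a b] i] [s t]] [mu nu]].
  destruct (step_exists T p q b i t HT HD Hpq) as (a' & b' & i' & t' & mu' & nu' & H1 & H2 & H3).
  exists ((a', b', i'), (t, t'), (mu', nu')); simpl; auto. }
set (a := fun j => fst (fst (fst (fst (f (S j)))))).
set (b := fun j => snd (fst (fst (fst (f (S j)))))).
set (phi := fun j => snd (fst (fst (f (S j))))).
set (s := fun j => fst (snd (fst (f (S j))))).
set (t := fun j => snd (snd (fst (f (S j))))).
set (mu := fun j => fst (snd (f (S j)))).
set (nu := fun j => snd (snd (f (S j)))).
assert (Hstep : forall j, step T Y p q (a j) (b j) (phi j) (s j) (t j) (mu j) (nu j)).
{ intros j; assert (H := Hf j); unfold a, b, phi, s, t, mu, nu.
  destruct (f j) as [[[[? ?] ?] [? ?]] [? ?]], (f (S j)) as [[[[? ?] ?] [? ?]] [? ?]].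
  simpl in *; tauto. }
assert (Hnext : forall j, (b j <= a (S j) /\ phi j < phi (S j) /\ t j <= s (S j))%nat).
{ intros j; assert (H := Hf (S j)); unfold a, b, phi, s, t, mu, nu.
  destruct (f (S j)) as [[[[? ?] ?] [? ?]] [? ?]], (f (S (S j))) as [[[[? ?] ?] [? ?]] [? ?]].
  simpl in *; tauto. }
clearbody a b phi s t mu nu; clear f Hf Rel.
assert (Hphi : forall j, (phi j < phi (S j))%nat) by apply Hnext.
assert (Hst : forall j, (s j <= t j <= s (S j))%nat)
  by (intros j; split; [apply (step_st _ _ _ _ _ _ _ _ _ _ _ (Hstep j))|apply Hnext]).
assert (Hab : forall j, (a j <= b j <= a (S j))%nat)
  by (intros j; split; [apply (step_ab _ _ _ _ _ _ _ _ _ _ _ (Hstep j))|apply Hnext]).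
assert (Hbb : forall i j, (i <= j)%nat -> (b i <= b j)%nat).
{ apply increasing_le; intros j; assert (H1 := Hab j); assert (H2 := Hab (S j)); lia. }
set (J := fun j => shell T (s j) (t j)).
set (I := fun j k => (Nat.leb (a j) k && Nat.ltb k (b j))%bool).
set (w := fun j => multiplier (b j) (mu j) (Y (phi j))).
set (v := fun j => proj (J j) (w j)).
set (z := fun j => multiplier (b j) (nu j) (v j)).
set (P := fun j (pq : nat * nat) => (Nat.eqb (fst pq) (p (phi j)) && Nat.eqb (snd pq) (q (phi j)))%bool).
assert (Xw : forall j, X (w j)) by (intros; apply X_multiplier).
assert (Xv : forall j, X (v j)) by (intros; now apply X_pr).
assert (Xz : forall j, X (z j)) by (intros; apply X_multiplier).
assert (Hz : forall j, 1 / 4 <= z j (p (phi j)) (q (phi j)))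
  by (intros j; apply (step_val _ _ _ _ _ _ _ _ _ _ _ (Hstep j))).
assert (HJ : disjoint_family J) by now apply (shell_disjoint X nrm).
assert (HI : disjoint_family I).
{ assert (H : forall i j k, (i < j)%nat -> I i k = true -> I j k = true -> False).
  { intros i j k Hij Hi Hj; apply Bool.andb_true_iff in Hi, Hj.
    destruct Hi as [_ Hi], Hj as [Hj _].
    apply Nat.ltb_lt in Hi; apply Nat.leb_le in Hj.
    assert (Hs : (a (S i) <= a j)%nat).
    { apply increasing_le; [|lia]; intros n; specialize (Hab n); lia. }
    specialize (Hab i); lia. }
  intros i j k Hi Hj; destruct (Nat.lt_trichotomy i j) as [l|[e|l]]; trivial;
    [elim (H i j k l Hi Hj)|elim (H j i k l Hj Hi)]. }
assert (HP : disjoint_family P).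
{ intros i j [c d] Hi Hj; apply Bool.andb_true_iff in Hi, Hj; simpl in *.
  destruct Hi as [H1 H2], Hj as [H3 H4]; apply Nat.eqb_eq in H1, H2, H3, H4; subst c d.
  assert (E := Hinj _ _ H3 H4); assert (H := increasing_lt phi Hphi).
  destruct (Nat.lt_trichotomy i j) as [l|[e|l]]; trivial; specialize (H _ _ l); lia. }
assert (PY : forall j, proj (P j) (Y (phi j)) = Y (phi j)).
{ intros j; extensionality c; extensionality d; unfold proj, P, Y, unit_mat; simpl.
  now destruct (Nat.eqb c (p (phi j)) && Nat.eqb d (q (phi j)))%bool. }
(* Diagonal extraction needs one common length for all multipliers; since the [j]-th vanishes from
   [b j] on, [b N] serves. *)
assert (ext : forall N j (g : nat -> R) y, (j < N)%nat ->
   (forall k, I j k = false -> g k = 0) -> multiplier (b N) g y = multiplier (b j) g y).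
{ intros N j g y Hj Hg; apply multiplier_extend; [apply Hbb; lia|].
  intros k Hk; apply Hg; unfold I; destruct (Nat.ltb_spec k (b j)); [lia|].
  apply Bool.andb_false_r. }
exists phi, v; split; [trivial|split].
(* The lower bound holds because [z j], with an entry at least [1/4], has norm at most [K] times
   that of [v j]; the upper one is the bound of the multiplier [mu j] on a unit matrix. *)
- exists s, t, (/ K * (1 / 4)), (4 * K); split.
  { apply Rmult_lt_0_compat; [apply Rinv_0_lt_compat|]; lra. }
  intros j; split; [apply Hst|split; [apply Xv|split; [apply proj_idem|split]]].
  + apply Rmult_le_reg_l with K; [lra|].
    rewrite <- Rmult_assoc, Rinv_r, Rmult_1_l by lra.
    eapply Rle_trans; [apply Hz|]; eapply Rle_trans; [apply Rle_abs|].
    eapply Rle_trans; [now apply (lm_coord _ _ L)|].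
    rewrite <- (Rmult_1_l K); apply multiplier_bound; trivial; [lra|].
    apply (step_nu _ _ _ _ _ _ _ _ _ _ _ (Hstep j)).
  + eapply Rle_trans; [now apply (nrm_proj X nrm L)|].
    rewrite <- (Rmult_1_r (4 * K)), <- (proj2 (lm_unit _ _ L (p (phi j)) (q (phi j)))).
    apply multiplier_bound; [apply (lm_unit _ _ L)|lra|].
    apply (step_mu _ _ _ _ _ _ _ _ _ _ _ (Hstep j)).
- exists (4 * K); split; [lra|]; intros N c; split.
  (* The signs demanded by [proj_diag] are absorbed into the multipliers [nu j], whose bound [1]
     they preserve. *)
  + assert (G : nrm (msum N (fun j => proj (P j) (mscal (c j) (z j)))) <=
       K * nrm (lcomb N c v)).
    { apply (proj_diag X nrm L); trivial; [intros; now apply X_sc|].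
      intros th Hth; rewrite <- (Rmult_1_l K).
      eapply Rle_trans; [right|apply (multiplier_diag N (b N) I J
        (fun j k => th j * nu j k) (fun j => mscal (c j) (v j)))]; trivial.
      - f_equal; extensionality i; extensionality j; apply fsum_ext; intros l Hl.
        rewrite multiplier_mscal, multiplier_scal_l, !mscal_mscal by trivial.
        rewrite (ext N l) by (trivial; intros k;
          apply (step_out _ _ _ _ _ _ _ _ _ _ _ (Hstep l) k)).
        now rewrite Rmult_comm.
      - intros; now apply X_sc.
      - intros j; rewrite proj_mscal; f_equal; apply proj_idem.
      - lra.
      - intros j k; rewrite Rabs_mult, signs_abs, Rmult_1_l by trivial.
        apply (step_nu _ _ _ _ _ _ _ _ _ _ _ (Hstep j)).
      - intros j k H; rewrite (proj2 (step_out _ _ _ _ _ _ _ _ _ _ _ (Hstep j) k H)); ring. }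
    set (tau := fun j => z j (p (phi j)) (q (phi j))).
    assert (E : forall j, proj (P j) (mscal (c j) (z j)) = mscal (c j * tau j) (Y (phi j))).
    { intros j; extensionality k; extensionality l; unfold proj, mscal, P, Y, unit_mat, tau; simpl.
      destruct (Nat.eqb_spec k (p (phi j))) as [->|]; simpl; [|ring].
      destruct (Nat.eqb_spec l (q (phi j))) as [->|]; ring. }
    (* At its own position [z j] is [tau j] times the unit matrix; dividing by [tau j >= 1/4] costs
       the factor [4]. *)
    apply Rle_trans with (4 * nrm (msum N (fun j => proj (P j) (mscal (c j) (z j))))); [|lra].
    eapply Rle_trans; [right|apply (nrm_flip X nrm L N P _ (fun j => / tau j)); trivial].
    * f_equal; extensionality k; extensionality l; apply fsum_ext; intros j _.
      rewrite E; unfold mscal; fold (Y (phi j)); field.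
      specialize (Hz j); fold (tau j) in Hz; lra.
    * intros; apply X_pr; now apply X_sc.
    * intros; apply proj_idem.
    * lra.
    * intros j; specialize (Hz j); fold (tau j) in Hz; rewrite Rabs_inv, Rabs_pos_eq by lra.
      replace 4 with (/ (1 / 4)) by field; apply Rinv_le_contravar; lra.
  + replace (lcomb N c v) with (msum N (fun j => proj (J j) (mscal (c j) (w j)))).
    * apply (proj_diag X nrm L); trivial; [intros; now apply X_sc|].
      intros th Hth.
      eapply Rle_trans; [right|apply (multiplier_diag N (b N) I P
        (fun j k => th j * mu j k) (fun j => mscal (c j) (Y (phi j))))]; trivial.
      -- f_equal; extensionality i; extensionality j; apply fsum_ext; intros l Hl.
         rewrite multiplier_mscal, multiplier_scal_l, !mscal_mscal by trivial.
         rewrite (ext N l) by (trivial; intros k;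
           apply (step_out _ _ _ _ _ _ _ _ _ _ _ (Hstep l) k)).
         now rewrite Rmult_comm.
      -- intros; now apply X_sc.
      -- intros j; rewrite proj_mscal; now f_equal.
      -- lra.
      -- intros j k; rewrite Rabs_mult, signs_abs, Rmult_1_l by trivial.
         apply (step_mu _ _ _ _ _ _ _ _ _ _ _ (Hstep j)).
      -- intros j k H; rewrite (proj1 (step_out _ _ _ _ _ _ _ _ _ _ _ (Hstep j) k H)); ring.
    * extensionality k; extensionality l; apply fsum_ext; intros j _.
      now rewrite proj_mscal.
Qed.
End Basis.

(** * Mixed norms *)

Section Sequence_norm.
Variables (mem : (nat -> R) -> Prop) (nr : (nat -> R) -> R) (L : lat_seq mem nr).

Lemma ls_zero : mem (fun _ => 0) /\ nr (fun _ => 0) = 0.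
Proof.
destruct (ls_scal _ _ L 0 (unit_seq 0) (proj1 (ls_unit _ _ L 0%nat))) as [H1 H2].
replace (fun i => 0 * unit_seq 0 i) with (fun _ : nat => 0) in H1, H2
  by (extensionality i; ring).
rewrite Rabs_R0, Rmult_0_l in H2; now split.
Qed.

Lemma ls_nonneg (f : nat -> R) : mem f -> 0 <= nr f.
Proof. intros H; eapply Rle_trans; [apply Rabs_pos|exact (ls_coord _ _ L f 0%nat H)]. Qed.

Lemma ls_abs (f : nat -> R) : mem f -> mem (fun i => Rabs (f i)) /\ nr (fun i => Rabs (f i)) = nr f.
Proof.
intros H.
destruct (ls_lat _ _ L (fun i => Rabs (f i)) f H) as [H1 H2]; [intros; rewrite Rabs_Rabsolu; lra|].
split; trivial; apply Rle_antisym; trivial.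
apply (ls_lat _ _ L); trivial; intros; rewrite Rabs_Rabsolu; lra.
Qed.

Lemma ls_fsum (N : nat) (w : nat -> nat -> R) : (forall j, mem (w j)) ->
  mem (fun i => fsum N (fun j => w j i)) /\
  nr (fun i => fsum N (fun j => w j i)) <= fsum N (fun j => nr (w j)).
Proof.
intros Hw; induction N as [|N [IH1 IH2]]; simpl.
- destruct ls_zero; split; trivial; lra.
- destruct (ls_add _ _ L _ _ IH1 (Hw N)) as [H1 H2]; split; trivial; lra.
Qed.

(** The blocks are added one by one with [ls_disj], each being disjoint from the sum of the previous
    ones. *)
Lemma ls_compare (N : nat) (w w' : nat -> nat -> R) (D D' : nat -> nat -> bool) :
  (forall j, mem (w j)) -> (forall j, mem (w' j)) -> disjoint_family D -> disjoint_family D' ->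
  (forall j i, D j i = false -> w j i = 0) -> (forall j i, D' j i = false -> w' j i = 0) ->
  (forall j, nr (w j) <= nr (w' j)) ->
  nr (fun i => fsum N (fun j => w j i)) <= nr (fun i => fsum N (fun j => w' j i)).
Proof.
intros Hw Hw' HD HD' Hz Hz' Hle; induction N as [|N IH]; simpl; [lra|].
assert (disj : forall (w : nat -> nat -> R) D, disjoint_family D ->
  (forall j i, D j i = false -> w j i = 0) ->
  forall i, fsum N (fun j => w j i) = 0 \/ w N i = 0).
{ clear; intros w D HD Hz i; destruct (D N i) eqn:E; [left|right; now apply Hz].
  apply fsum_0; intros k Hk; apply Hz; destruct (D k i) eqn:F; trivial.
  assert (H := HD _ _ _ E F); lia. }
apply (ls_disj _ _ L); trivial.
- now apply ls_fsum.
- now apply ls_fsum.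
- now apply (disj w D).
- now apply (disj w' D').
Qed.

Lemma unit_disjoint : disjoint_family (fun j i : nat => Nat.eqb i j).
Proof. intros i j k Hi Hj; apply Nat.eqb_eq in Hi, Hj; congruence. Qed.

Lemma trunc_units (N : nat) (a : nat -> R) :
  (fun i => fsum N (fun j => a j * unit_seq j i)) = trunc N a.
Proof.
extensionality i; unfold trunc; destruct (Nat.ltb_spec i N).
- rewrite (fsum_single _ i); trivial; unfold unit_seq; [rewrite Nat.eqb_refl; ring|].
  intros k _ Hk; destruct (Nat.eqb_spec i k); [congruence|ring].
- apply fsum_0; intros k Hk; unfold unit_seq; destruct (Nat.eqb_spec i k); [lia|ring].
Qed.

Lemma ls_scaled_unit (c : R) (n : nat) :
  mem (fun i => c * unit_seq n i) /\ nr (fun i => c * unit_seq n i) = Rabs c.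
Proof.
destruct (ls_unit _ _ L n) as [H1 H2]; destruct (ls_scal _ _ L c _ H1) as [H3 H4].
split; trivial; rewrite H4, H2; ring.
Qed.

Lemma mem_trunc (N : nat) (a : nat -> R) : mem (trunc N a).
Proof.
rewrite <- trunc_units; apply (ls_fsum N (fun j i => a j * unit_seq j i)).
intros; apply ls_scaled_unit.
Qed.

Lemma ls_trunc_scal (N : nat) (c : R) (a : nat -> R) : 0 <= c ->
  nr (trunc N (fun k => c * Rabs (a k))) = c * nr (trunc N a).
Proof.
intros Hc; destruct (ls_abs _ (mem_trunc N a)) as [H1 H2].
destruct (ls_scal _ _ L c _ H1) as [_ H3]; rewrite Rabs_pos_eq in H3 by trivial.
rewrite <- H2, <- H3; f_equal; extensionality i; unfold trunc; destruct (Nat.ltb i N);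
  rewrite ?Rabs_R0; ring.
Qed.

Lemma ls_block_upper (N : nat) (w : nat -> nat -> R) (D : nat -> nat -> bool) (a : nat -> R)
  (C : R) : (forall j, mem (w j)) -> disjoint_family D ->
  (forall j i, D j i = false -> w j i = 0) -> 0 <= C -> (forall j, nr (w j) <= C) ->
  nr (fun i => fsum N (fun j => a j * w j i)) <= C * nr (trunc N a).
Proof.
intros Hw HD Hz HC Hle; rewrite <- ls_trunc_scal, <- trunc_units by trivial.
apply (ls_compare N (fun j i => a j * w j i) (fun j i => C * Rabs (a j) * unit_seq j i)
  D (fun j i => Nat.eqb i j)); trivial.
- intros; now apply (ls_scal _ _ L).
- intros; apply ls_scaled_unit.
- apply unit_disjoint.
- intros j i H; rewrite Hz by trivial; ring.
- intros j i H; unfold unit_seq; rewrite H; ring.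
- intros j; rewrite (proj2 (ls_scaled_unit _ _)), (proj2 (ls_scal _ _ L _ _ (Hw j))).
  rewrite Rabs_mult, Rabs_Rabsolu, (Rabs_pos_eq C), (Rmult_comm C) by trivial.
  apply Rmult_le_compat_l; [apply Rabs_pos|apply Hle].
Qed.

(** The bounds [c j] may vary and even vanish: a block spread over several columns has no uniform
    lower bound on any single column. *)
Lemma ls_block_lower (N : nat) (w : nat -> nat -> R) (D : nat -> nat -> bool) (a c : nat -> R) :
  (forall j, mem (w j)) -> disjoint_family D ->
  (forall j i, D j i = false -> w j i = 0) -> (forall j, 0 <= c j <= nr (w j)) ->
  nr (trunc N (fun k => c k * Rabs (a k))) <= nr (fun i => fsum N (fun j => a j * w j i)).
Proof.
intros Hw HD Hz Hc; rewrite <- trunc_units.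
apply (ls_compare N (fun j i => c j * Rabs (a j) * unit_seq j i) (fun j i => a j * w j i)
  (fun j i => Nat.eqb i j) D); trivial.
- intros; apply ls_scaled_unit.
- intros; now apply (ls_scal _ _ L).
- apply unit_disjoint.
- intros j i H; unfold unit_seq; rewrite H; ring.
- intros j i H; rewrite Hz by trivial; ring.
- intros j; rewrite (proj2 (ls_scaled_unit _ _)), (proj2 (ls_scal _ _ L _ _ (Hw j))).
  destruct (Hc j) as [H1 H2].
  rewrite Rabs_mult, Rabs_Rabsolu, (Rabs_pos_eq (c j)), (Rmult_comm (c j)) by trivial.
  apply Rmult_le_compat_l; [apply Rabs_pos|trivial].
Qed.
(** Sums of equally many unit vectors have equal norms, by comparison in both directions. The shift
    is needed for greedy bases, where one subsequence is started late to avoid the other. *)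
Lemma ls_interval (s N : nat) :
  nr (trunc (s + N) (fun k => if Nat.leb s k then 1 else 0)) = nr (trunc N (fun _ => 1)).
Proof.
assert (E1 : trunc (s + N) (fun k => if Nat.leb s k then 1 else 0) =
   fun i => fsum N (fun j => unit_seq (s + j) i)).
{ extensionality i; unfold trunc; destruct (Nat.ltb_spec i (s + N)).
  - destruct (Nat.leb_spec s i).
    + rewrite (fsum_single N (i - s)); [|lia|].
      * unfold unit_seq; destruct (Nat.eqb_spec i (s + (i - s))); [reflexivity|lia].
      * intros k _ Hk; unfold unit_seq; destruct (Nat.eqb_spec i (s + k)); [lia|reflexivity].
    + rewrite fsum_0; trivial.
      intros k _; unfold unit_seq; destruct (Nat.eqb_spec i (s + k)); [lia|reflexivity].
  - rewrite fsum_0; trivial.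
    intros k Hk; unfold unit_seq; destruct (Nat.eqb_spec i (s + k)); [lia|reflexivity]. }
assert (E2 : trunc N (fun _ => 1) = fun i => fsum N (fun j => unit_seq j i)).
{ rewrite <- trunc_units; extensionality i; apply fsum_ext; intros; ring. }
rewrite E1, E2.
assert (U : forall n, mem (unit_seq n)) by (intros; apply (ls_unit _ _ L)).
assert (N1 : forall n, nr (unit_seq n) = 1) by (intros; apply (ls_unit _ _ L)).
assert (off : forall n i, Nat.eqb i n = false -> unit_seq n i = 0)
  by (intros n i H; unfold unit_seq; now rewrite H).
assert (D : disjoint_family (fun j i => Nat.eqb i (s + j)))
  by (intros i j k Hi Hj; apply Nat.eqb_eq in Hi, Hj; lia).
apply Rle_antisym.
- apply (ls_compare N (fun j => unit_seq (s + j)) unit_seq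
    (fun j i => Nat.eqb i (s + j)) (fun j i => Nat.eqb i j)); auto using unit_disjoint.
  intros; rewrite !N1; lra.
- apply (ls_compare N unit_seq (fun j => unit_seq (s + j))
    (fun j i => Nat.eqb i j) (fun j i => Nat.eqb i (s + j))); auto using unit_disjoint.
  intros; rewrite !N1; lra.
Qed.
End Sequence_norm.

(** * Regions and their blocks in the mixed-norm spaces *)

Definition tail_columns (t : nat) (p : nat * nat) : bool := Nat.leb t (snd p).
(** The restriction to [k] columns makes these shells see the inner norm: over all columns, the unit
    matrices at [(n, n)] would lie in disjoint shells and span the outer space. *)
Definition tail_rows (k t : nat) (p : nat * nat) : bool :=
  (Nat.leb t (fst p) && Nat.ltb (snd p) k)%bool.

Section Mixed.
Variables (e f : expo) (He : valid e) (Hf : valid f).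

Let X := mix_mem e f.
Let nrm := mix_norm e f.
Let Le := valid_lat_seq e He.
Let Lf := valid_lat_seq f Hf.
Let column (y : mat) (j : nat) : R := seq_norm e (fun i => y i j).

Lemma column_nonneg (y : mat) (j : nat) : X y -> 0 <= column y j.
Proof. intros H; apply (ls_nonneg _ _ Le), H. Qed.

Lemma mix_lat_mat : lat_mat X nrm.
Proof.
constructor.
- intros y z Hz H.
  assert (G : forall j, seq_mem e (fun i => y i j) /\ column y j <= column z j)
    by (intros j; apply (ls_lat _ _ Le); auto; apply Hz).
  assert (G2 : forall j, Rabs (column y j) <= Rabs (column z j)).
  { intros j; rewrite !Rabs_pos_eq; [apply G|now apply column_nonneg|].
    apply (ls_nonneg _ _ Le), G. }
  destruct (ls_lat _ _ Lf _ _ (proj2 Hz) G2) as [G3 G4].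
  split; trivial; split; trivial; apply G.
- intros y z Hy Hz.
  assert (G : forall j, seq_mem e (fun i => madd y z i j) /\
     column (madd y z) j <= column y j + column z j)
    by (intros j; apply (ls_add _ _ Le); [apply Hy|apply Hz]).
  destruct (ls_add _ _ Lf _ _ (proj2 Hy) (proj2 Hz)) as [A1 A2].
  assert (G2 : forall j, Rabs (column (madd y z) j) <= Rabs (column y j + column z j)).
  { intros j; assert (H1 := column_nonneg y j Hy); assert (H2 := column_nonneg z j Hz).
    rewrite !Rabs_pos_eq; [apply G|lra|].
    apply (ls_nonneg _ _ Le), G. }
  destruct (ls_lat _ _ Lf _ _ A1 G2) as [G3 G4].
  split; [split; trivial; apply G|].
  eapply Rle_trans; [exact G4|exact A2].
- intros c y Hy.
  assert (G : forall j, seq_mem e (fun i => mscal c y i j) /\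
     column (mscal c y) j = Rabs c * column y j)
    by (intros j; apply (ls_scal _ _ Le); apply Hy).
  destruct (ls_scal _ _ Lf (Rabs c) _ (proj2 Hy)) as [H1 H2]; rewrite Rabs_Rabsolu in H2.
  assert (E : column (mscal c y) = fun j => Rabs c * column y j)
    by (extensionality j; apply G).
  split; [split; [apply G|]|].
  + change (seq_mem f (column (mscal c y))); rewrite E; exact H1.
  + change (seq_norm f (column (mscal c y)) = Rabs c * nrm y); rewrite E; exact H2.
- intros y i j Hy; eapply Rle_trans; [exact (ls_coord _ _ Le _ i (proj1 Hy j))|].
  eapply Rle_trans; [apply Rle_abs|exact (ls_coord _ _ Lf _ j (proj2 Hy))].
- intros p q.
  assert (G : forall j, seq_mem e (fun i => unit_mat p q i j) /\
     column (unit_mat p q) j = unit_seq q j).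
  { intros j; unfold column, unit_seq at 1; destruct (Nat.eqb_spec j q) as [->|Hj].
    - replace (fun i => unit_mat p q i q) with (unit_seq p); [apply (ls_unit _ _ Le)|].
      extensionality i; unfold unit_mat; rewrite Nat.eqb_refl, Bool.andb_true_r; reflexivity.
    - replace (fun i => unit_mat p q i j) with (fun _ : nat => 0); [apply (ls_zero _ _ Le)|].
      extensionality i; unfold unit_mat; destruct (Nat.eqb_spec j q); [easy|].
      now rewrite Bool.andb_false_r. }
  assert (E : column (unit_mat p q) = unit_seq q) by (extensionality j; apply G).
  destruct (ls_unit _ _ Lf q) as [H1 H2].
  split; [split; [apply G|]|].
  + change (seq_mem f (column (unit_mat p q))); now rewrite E.
  + change (seq_norm f (column (unit_mat p q)) = 1); now rewrite E.
Qed.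

Let L := mix_lat_mat.

Lemma column_le_nrm (y : mat) (j : nat) : X y -> column y j <= nrm y.
Proof.
intros Hy; eapply Rle_trans; [apply Rle_abs|exact (ls_coord _ _ Lf _ j (proj2 Hy))].
Qed.

Lemma column_zero (y : mat) (j : nat) : (forall i, y i j = 0) -> column y j = 0.
Proof.
intros H; unfold column; replace (fun i => y i j) with (fun _ : nat => 0);
  [apply (ls_zero _ _ Le)|extensionality i; now rewrite H].
Qed.

(** The triangle inequality of the outer norm. Together with [column_le_nrm] it makes the norm on
    [k] columns comparable to the sum of the inner norms. *)
Lemma nrm_le_columns (k : nat) (y : mat) : X y -> (forall i j, (k <= j)%nat -> y i j = 0) ->
  nrm y <= fsum k (column y).
Proof.
intros Hy Hk; change (nrm y) with (seq_norm f (column y)).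
replace (column y) with (fun i => fsum k (fun j => column y j * unit_seq j i)) at 1.
- eapply Rle_trans;
    [apply (ls_fsum _ _ Lf k (fun j i => column y j * unit_seq j i))|].
  + intros; now apply (ls_scaled_unit _ _ Lf).
  + right; apply fsum_ext; intros j _.
    rewrite (proj2 (ls_scaled_unit _ _ Lf _ _)); apply Rabs_pos_eq; now apply column_nonneg.
- rewrite trunc_units; extensionality j; unfold trunc; destruct (Nat.ltb_spec j k); trivial.
  symmetry; apply column_zero; auto.
Qed.

Lemma region_columns : region X nrm tail_columns.
Proof.
constructor.
- intros s t [i j] H; unfold tail_columns; simpl; rewrite !Nat.leb_le; lia.
- intros y eps Hy Heps; destruct (ls_tail _ _ Lf _ eps (proj2 Hy) Heps) as [t Ht].
  exists t; eapply Rle_lt_trans; [right|exact Ht].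
  unfold nrm, mix_norm; f_equal; extensionality j; unfold proj, tail_columns; simpl.
  destruct (Nat.leb t j); trivial; apply (ls_zero _ _ Le).
Qed.

(** The tails of the [k] columns are made small one after another, and the largest of the [k]
    indices serves for all of them. *)
Lemma region_rows (k : nat) : region X nrm (tail_rows k).
Proof.
constructor.
- intros s t [i j] H; unfold tail_rows; simpl.
  rewrite !Bool.andb_true_iff, !Nat.leb_le; intuition lia.
- intros y eps Hy Heps.
  set (tl := fun t (j : nat) => seq_norm e (fun i => if Nat.leb t i then y i j else 0)).
  assert (mono : forall s t j, (s <= t)%nat -> tl t j <= tl s j).
  { intros s t j H; apply (ls_lat _ _ Le).
    - apply (ls_lat _ _ Le _ _ (proj1 Hy j)).
      intros i; destruct (Nat.leb s i); [lra|rewrite Rabs_R0; apply Rabs_pos].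
    - intros i; destruct (Nat.leb_spec t i), (Nat.leb_spec s i); try lia; try lra.
      rewrite Rabs_R0; apply Rabs_pos. }
  assert (G : forall l eps, 0 < eps -> exists t, fsum l (tl t) < eps).
  { induction l as [|l IH]; intros d Hd; simpl; [now exists 0%nat|].
    destruct (IH (d / 2)) as [t1 H1]; [lra|].
    destruct (ls_tail _ _ Le _ (d / 2) (proj1 Hy l)) as [t2 H2]; [lra|].
    change (tl t2 l < d / 2) in H2.
    exists (Nat.max t1 t2).
    assert (H3 := mono t2 (Nat.max t1 t2) l ltac:(lia)).
    assert (H4 : fsum l (tl (Nat.max t1 t2)) <= fsum l (tl t1))
      by (apply fsum_le; intros; apply mono; lia).
    lra. }
  destruct (G k eps Heps) as [t Ht]; exists t.
  eapply Rle_lt_trans; [apply (nrm_le_columns k)|].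
  + now apply (X_proj X nrm L).
  + intros i j H; unfold proj, tail_rows; simpl.
    destruct (Nat.ltb_spec j k); [lia|]; now rewrite Bool.andb_false_r.
  + eapply Rle_lt_trans; [right|exact Ht]; apply fsum_ext; intros j Hj.
    unfold column, tl; f_equal; extensionality i; unfold proj, tail_rows; simpl.
    destruct (Nat.ltb_spec j k); [|lia]; now rewrite Bool.andb_true_r.
Qed.

(** Each column meets at most one block, so the column norms of a combination form a disjoint sum of
    the column norms of the blocks, to which the block estimates of the outer space apply. *)
Lemma column_blocks_equiv (v : nat -> mat) :
  blocks X nrm tail_columns v -> equiv_unit_basis nrm v f.
Proof.
intros (s & t & c & C & Hc & H).
assert (HD := shell_disjoint _ _ _ s t region_columns (fun j => proj1 (H j))).
set (D := fun j l => shell tail_columns (s j) (t j) (0%nat, l)).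
assert (HD' : disjoint_family D) by (intros i j l; apply HD).
assert (Xv : forall j, X (v j)) by apply H.
assert (Hz : forall j i l, D j l = false -> v j i l = 0).
{ intros j i l Hj; destruct (H j) as (_ & _ & E & _); rewrite <- E; unfold proj.
  change (shell tail_columns (s j) (t j) (i, l)) with (D j l); now rewrite Hj. }
assert (Hz' : forall j l, D j l = false -> column (v j) l = 0)
  by (intros j l Hj; apply column_zero; auto).
assert (E : forall N a, nrm (lcomb N a v) =
   seq_norm f (fun l => fsum N (fun j => Rabs (a j) * column (v j) l))).
{ intros N a; unfold nrm, mix_norm; f_equal; extensionality l.
  assert (dec : (exists j, (j < N)%nat /\ D j l = true) \/
     forall j, (j < N)%nat -> D j l = false).
  { destruct (classic (exists j, (j < N)%nat /\ D j l = true)) as [|Hn]; [now left|right].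
    intros j Hj; destruct (D j l) eqn:F; trivial; elim Hn; now exists j. }
  destruct dec as [[j [Hj Dj]]|Hn].
  - assert (off : forall k, k <> j -> D k l = false).
    { intros k Hk; destruct (D k l) eqn:F; trivial; elim Hk; now apply (HD' k j l). }
    rewrite (fsum_single _ j); trivial.
    + change (column (lcomb N a v) l = Rabs (a j) * column (v j) l).
      unfold column; rewrite <- (proj2 (ls_scal _ _ Le (a j) _ (proj1 (Xv j) l))).
      f_equal; extensionality i; unfold lcomb; rewrite (fsum_single _ j); trivial.
      intros k _ Hk; rewrite Hz by auto; ring.
    + intros k _ Hk; rewrite Hz' by auto; ring.
  - rewrite fsum_0 by (intros k Hk; rewrite Hz' by auto; ring).
    apply (column_zero (lcomb N a v)); intros i; apply fsum_0; intros k Hk.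
    rewrite Hz by auto; ring. }
assert (cC : c <= C) by (destruct (H 0%nat) as (_ & _ & _ & H1); lra).
exists c, C; split; [lra|]; intros N a; rewrite E.
assert (tr : seq_norm f (trunc N (fun k => Rabs (a k))) = seq_norm f (trunc N a)).
{ rewrite <- (Rmult_1_l (seq_norm f (trunc N a))), <- (ls_trunc_scal _ _ Lf) by lra.
  f_equal; unfold trunc; extensionality k; now rewrite Rmult_1_l. }
split; rewrite <- tr.
- rewrite <- (ls_trunc_scal _ _ Lf) by lra.
  apply (ls_block_lower _ _ Lf N (fun j => column (v j)) D (fun k => Rabs (a k)) (fun _ => c));
    trivial; intros j; [apply Xv|].
  destruct (H j) as (_ & _ & _ & H1); split; [lra|apply H1].
- apply (ls_block_upper _ _ Lf N (fun j => column (v j)) D); trivial; [apply Xv|lra|].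
  intros j; apply H.
Qed.

(** In each of the [k] columns the blocks have disjoint supports, so the block estimates of the
    inner space apply column by column; summing over the columns costs a factor of order [k]. *)
Lemma row_blocks_equiv (k : nat) (v : nat -> mat) :
  blocks X nrm (tail_rows k) v -> equiv_unit_basis nrm v e.
Proof.
intros (s & t & c & C & Hc & H).
assert (Xv : forall j, X (v j)) by apply H.
assert (XW : forall N a, X (lcomb N a v)) by (intros; now apply (X_lcomb X nrm L)).
assert (supp : forall j i l, v j i l <> 0 -> (s j <= i < t j)%nat /\ (l < k)%nat).
{ intros j i l Hn; destruct (H j) as (_ & _ & E & _); rewrite <- E in Hn; unfold proj in Hn.
  destruct (shell (tail_rows k) (s j) (t j) (i, l)) eqn:F; [|easy]; revert F.
  unfold shell, tail_rows; simpl.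
  destruct (Nat.leb_spec (s j) i), (Nat.leb_spec (t j) i), (Nat.ltb_spec l k); simpl; easy. }
set (D := fun j i => (Nat.leb (s j) i && Nat.ltb i (t j))%bool).
assert (HD : disjoint_family D).
{ assert (K : forall i j l, (i < j)%nat -> D i l = true -> D j l = true -> False).
  { intros i j l Hij Hi Hj; apply Bool.andb_true_iff in Hi, Hj.
    rewrite Nat.leb_le, Nat.ltb_lt in Hi, Hj.
    assert (Hs : (s (S i) <= s j)%nat).
    { apply increasing_le; [|lia]; intros n; destruct (H n); lia. }
    destruct (H i); lia. }
  intros i j l Hi Hj; destruct (Nat.lt_trichotomy i j) as [g|[g|g]]; trivial;
    [elim (K i j l g Hi Hj)|elim (K j i l g Hj Hi)]. }
assert (Hz : forall l j i, D j i = false -> v j i l = 0).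
{ intros l j i Hj; apply NNPP; intros Hn; apply supp in Hn; revert Hj; unfold D.
  destruct (Nat.leb_spec (s j) i), (Nat.ltb_spec i (t j)); simpl; [easy|lia|lia|lia]. }
assert (Hk : forall j i l, (k <= l)%nat -> v j i l = 0).
{ intros j i l Hl; apply NNPP; intros Hn; apply supp in Hn; lia. }
assert (kp := pos_INR k).
assert (cC : c <= C) by (destruct (H 0%nat) as (_ & _ & _ & H1); lra).
assert (c1 : c / (INR k + 1) <= c).
{ apply Rmult_le_reg_r with (INR k + 1); [lra|].
  unfold Rdiv; rewrite Rmult_assoc, Rinv_l by lra; nra. }
(* [k + 1] instead of [k] keeps the constants positive also for [k = 0]. *)
exists (c / (INR k + 1)), ((INR k + 1) * C); split.
{ split; [apply Rdiv_lt_0_compat; lra|nra]. }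
intros N a; split.
- apply Rmult_le_reg_l with (INR k + 1); [lra|].
  replace ((INR k + 1) * (c / (INR k + 1) * seq_norm e (trunc N a))) with
    (c * seq_norm e (trunc N a)) by (field; lra).
  rewrite <- (ls_trunc_scal _ _ Le) by lra.
  apply Rle_trans with (INR k * nrm (lcomb N a v)).
  2: { apply Rmult_le_compat_r; [apply (nrm_nonneg X nrm L); auto|lra]. }
  (* The norm of a block is at most the sum of its column norms, so [c] can be distributed over the
     columns before the triangle inequality of the inner norm is used. *)
  apply Rle_trans with (seq_norm e (fun i =>
     fsum k (fun l => trunc N (fun j => column (v j) l * Rabs (a j)) i))).
  + apply (ls_lat _ _ Le).
    { apply (ls_fsum _ _ Le k (fun l => trunc N (fun j => column (v j) l * Rabs (a j)))).
      intros; apply (mem_trunc _ _ Le). }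
    intros j; unfold trunc; destruct (Nat.ltb j N).
    * rewrite (fsum_ext k _ (fun l => Rabs (a j) * column (v j) l)) by (intros; ring).
      rewrite fsum_scal, Rmult_comm, !Rabs_mult.
      apply Rmult_le_compat_l; [apply Rabs_pos|].
      eapply Rle_trans; [|apply Rle_abs]; rewrite Rabs_pos_eq by lra.
      eapply Rle_trans; [|apply nrm_le_columns; auto]; apply H.
    * rewrite Rabs_R0; apply Rabs_pos.
  + eapply Rle_trans; [apply (ls_fsum _ _ Le k
      (fun l => trunc N (fun j => column (v j) l * Rabs (a j))))|].
    { intros; apply (mem_trunc _ _ Le). }
    rewrite <- fsum_const; apply fsum_le; intros l _.
    eapply Rle_trans; [|apply (column_le_nrm _ l); auto].
    apply (ls_block_lower _ _ Le N (fun j i => v j i l) D a (fun j => column (v j) l)); trivial.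
    * intros j; apply Xv.
    * auto.
    * intros j; split; [now apply column_nonneg|apply Rle_refl].
- eapply Rle_trans; [apply (nrm_le_columns k); auto|].
  { intros i l Hl; apply fsum_0; intros j _; rewrite Hk by trivial; ring. }
  apply Rle_trans with (fsum k (fun _ => C * seq_norm e (trunc N a))).
  + apply fsum_le; intros l _.
    apply (ls_block_upper _ _ Le N (fun j i => v j i l) D); trivial; auto.
    * intros j; apply Xv.
    * lra.
    * intros j; apply Rle_trans with (nrm (v j)); [now apply column_le_nrm|apply H].
  + rewrite fsum_const, Rmult_assoc; apply Rmult_le_compat_r; [|lra].
    apply Rmult_le_pos; [lra|]; apply (ls_nonneg _ _ Le), (mem_trunc _ _ Le).
Qed.

Lemma unit_column_blocks (phi : nat -> nat) : (forall n, (phi n < phi (S n))%nat) ->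
  blocks X nrm tail_columns (fun n => unit_mat 0 (phi n)).
Proof.
intros Hphi; exists phi, (fun n => S (phi n)), 1, 1; split; [lra|].
intros j; destruct (lm_unit _ _ L 0%nat (phi j)) as [H1 H2].
split; [specialize (Hphi j); lia|split; [trivial|split; [|rewrite H2; lra]]].
extensionality p; extensionality q; unfold proj, shell, tail_columns, unit_mat; cbn [snd].
destruct (Nat.leb_spec (phi j) q), (Nat.leb_spec (S (phi j)) q), (Nat.eqb_spec q (phi j));
  cbn; rewrite ?Bool.andb_false_r; try reflexivity; lia.
Qed.

Lemma unit_row_blocks (phi : nat -> nat) : (forall n, (phi n < phi (S n))%nat) ->
  blocks X nrm (tail_rows 1) (fun n => unit_mat (phi n) 0).
Proof.
intros Hphi; exists phi, (fun n => S (phi n)), 1, 1; split; [lra|].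
intros j; destruct (lm_unit _ _ L (phi j) 0%nat) as [H1 H2].
split; [specialize (Hphi j); lia|split; [trivial|split; [|rewrite H2; lra]]].
extensionality p; extensionality q; unfold proj, shell, tail_rows, unit_mat; cbn [fst snd].
destruct (Nat.leb_spec (phi j) p), (Nat.leb_spec (S (phi j)) p), (Nat.eqb_spec p (phi j)),
  (Nat.ltb_spec q 1), (Nat.eqb_spec q 0); cbn; try reflexivity; lia.
Qed.

Lemma region_entries_lim (T : nat -> nat * nat -> bool) (p q : nat -> nat) : region X nrm T ->
  (forall t i, (t <= i)%nat -> T t (p i, q i) = true) ->
  forall y, X y -> is_lim_seq (fun i => y (p i) (q i)) 0.
Proof.
intros HT H y Hy; apply lim0_spec; intros eps Heps.
destruct (region_tail _ _ _ HT y eps Hy Heps) as [t Ht]; exists t; intros i Hi.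
eapply Rle_lt_trans; [|exact Ht].
replace (y (p i) (q i)) with (proj (T t) y (p i) (q i)) by (unfold proj; now rewrite H).
apply (lm_coord _ _ L); now apply (X_proj X nrm L).
Qed.
End Mixed.

(** * Distinguishing the sequence spaces *)

(** The exponent of the fundamental function: the sum of [N] unit vectors has norm [N] to this
    power. *)
Definition growth (e : expo) : R := match e with Fin p => / p | Czero => 0 end.

Lemma growth_inj (e f : expo) : valid e -> valid f -> growth e = growth f -> e = f.
Proof.
assert (pos : forall p, 1 <= p -> / p <> 0) by (intros p Hp; apply Rinv_neq_0_compat; lra).
destruct e as [p|], f as [q|]; simpl; intros Hp Hq H; trivial.
- now rewrite <- (Rinv_inv p), H, Rinv_inv.
- now elim (pos p).
- now elim (pos q).
Qed.

(** Stated for [S N] because [Rpower], defined by [exp], is positive even at base [0], while the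
    empty sum has norm [0]. *)
Lemma norm_ones (e : expo) (N : nat) : valid e ->
  seq_norm e (trunc (S N) (fun _ => 1)) = Rpower (INR (S N)) (growth e).
Proof.
intros He; assert (HN : 0 < INR (S N)) by (apply lt_0_INR; lia).
destruct e as [p|]; simpl growth.
- assert (H : forall n, is_series (fun i => rpw (Rabs (trunc n (fun _ => 1) i)) p) (INR n)).
  { induction n as [|n IH].
    - apply (is_series_ext (fun i => if Nat.eqb i 0 then 0 else 0)); [|apply is_series_single].
      intros i; unfold trunc; simpl; rewrite Rabs_R0, rpw_0; now destruct (Nat.eqb i 0).
    - rewrite S_INR.
      apply (is_series_ext (fun i => plus (rpw (Rabs (trunc n (fun _ => 1) i)) p)
        (if Nat.eqb i n then 1 else 0))).
      + intros i; unfold plus, trunc; simpl.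
        destruct (Nat.ltb_spec i n), (Nat.ltb_spec i (S n)), (Nat.eqb_spec i n); try lia;
          rewrite ?Rabs_R1, ?Rabs_R0, ?rpw_1, ?rpw_0; ring.
      + apply (is_series_plus (V := R_NormedModule)); [exact IH|apply is_series_single]. }
  unfold seq_norm; rewrite (is_series_unique _ _ (H (S N))), rpw_pos by trivial.
  f_equal; field; simpl in He; lra.
- rewrite Rpower_O by trivial; apply Rle_antisym.
  + apply c0_norm_le; intros i; unfold trunc; destruct (Nat.ltb i (S N));
      rewrite ?Rabs_R1, ?Rabs_R0; lra.
  + assert (H := c0_coord (trunc (S N) (fun _ => 1)) 0 (mem_trunc _ _ c0_lat_seq _ _)).
    change (trunc (S N) (fun _ => 1) 0%nat) with 1 in H; now rewrite Rabs_R1 in H.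
Qed.

(** The two fundamental functions are powers with different exponents, so their ratio is
    unbounded. *)
Lemma norms_not_equivalent (e f : expo) (C : R) : valid e -> valid f -> e <> f ->
  (forall N, seq_norm e (trunc N (fun _ => 1)) <= C * seq_norm f (trunc N (fun _ => 1))) ->
  (forall N, seq_norm f (trunc N (fun _ => 1)) <= C * seq_norm e (trunc N (fun _ => 1))) ->
  False.
Proof.
assert (G : forall g h, g < h ->
  (forall N, Rpower (INR (S N)) h <= C * Rpower (INR (S N)) g) -> False).
{ intros g h Hgh H.
  assert (Hd : forall N, Rpower (INR (S N)) (h - g) <= C).
  { intros N; replace (h - g) with (h + - g) by ring; rewrite Rpower_plus, Rpower_Ropp.
    assert (0 < Rpower (INR (S N)) g) by apply exp_pos.
    apply Rmult_le_reg_r with (Rpower (INR (S N)) g); trivial.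
    rewrite Rmult_assoc, Rinv_l, Rmult_1_r by lra; apply H. }
  assert (C0 : 0 < C) by (eapply Rlt_le_trans; [apply exp_pos|apply (Hd 0%nat)]).
  (* Beyond this value the power [h - g] exceeds [C]. *)
  destruct (INR_unbounded (Rpower C (/ (h - g)))) as [N HN].
  specialize (Hd N); apply Rle_not_lt in Hd; apply Hd.
  replace C with (Rpower (Rpower C (/ (h - g))) (h - g)) at 1.
  - apply Rlt_Rpower_l; [lra|split; [apply exp_pos|]].
    rewrite S_INR; lra.
  - rewrite Rpower_mult, Rinv_l by lra; now apply Rpower_1. }
intros He Hf Hef H1 H2.
destruct (Rtotal_order (growth e) (growth f)) as [l|[E|l]].
- apply (G _ _ l); intros N; rewrite <- !norm_ones by trivial; apply H2.
- now apply Hef, growth_inj.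
- apply (G _ _ l); intros N; rewrite <- !norm_ones by trivial; apply H1.
Qed.

Lemma equivalent_unit_basis (nrm : mat -> R) (u v : nat -> mat) (e : expo) : valid e ->
  equivalent nrm u v -> equiv_unit_basis nrm v e -> equiv_unit_basis nrm u e.
Proof.
intros He (A & HA & H) (c & C & Hc & G).
(* The maximum only secures the required order of the two constants. *)
exists (c / A), (Rmax (A * C) (c / A)); split.
{ split; [apply Rdiv_lt_0_compat; lra|apply Rmax_r]. }
intros N a; destruct (H N a) as [H1 H2], (G N a) as [G1 G2].
assert (P : 0 <= seq_norm e (trunc N a)).
{ assert (Le := valid_lat_seq e He); apply (ls_nonneg _ _ Le), (mem_trunc _ _ Le). }
split.
- apply Rmult_le_reg_l with A; trivial.
  replace (A * (c / A * seq_norm e (trunc N a))) with (c * seq_norm e (trunc N a))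
    by (field; lra); lra.
- apply Rle_trans with (A * C * seq_norm e (trunc N a)).
  + eapply Rle_trans; [exact H1|rewrite Rmult_assoc; apply Rmult_le_compat_l; lra].
  + apply Rmult_le_compat_r; [trivial|apply Rmax_l].
Qed.

Lemma equiv_unit_basis_unique (nrm : mat -> R) (v : nat -> mat) (e f : expo) :
  valid e -> valid f -> equiv_unit_basis nrm v e -> equiv_unit_basis nrm v f -> e = f.
Proof.
intros He Hf (c & C & Hc & H) (d & D & Hd & G); apply NNPP; intros Hef.
assert (P : forall e, valid e -> forall N, 0 <= seq_norm e (trunc N (fun _ => 1))).
{ intros e' He' N; apply (ls_nonneg _ _ (valid_lat_seq _ He')), (mem_trunc _ _ (valid_lat_seq _ He')). }
apply (norms_not_equivalent e f (Rmax (D / c) (C / d)) He Hf Hef); intros N;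
  destruct (H N (fun _ => 1)) as [H1 H2], (G N (fun _ => 1)) as [G1 G2].
- apply Rle_trans with (D / c * seq_norm f (trunc N (fun _ => 1))).
  + apply Rmult_le_reg_l with c; [lra|].
    replace (c * (D / c * seq_norm f (trunc N (fun _ => 1)))) with
      (D * seq_norm f (trunc N (fun _ => 1))) by (field; lra); lra.
  + apply Rmult_le_compat_r; [now apply P|apply Rmax_l].
- apply Rle_trans with (C / d * seq_norm e (trunc N (fun _ => 1))).
  + apply Rmult_le_reg_l with d; [lra|].
    replace (d * (C / d * seq_norm e (trunc N (fun _ => 1)))) with
      (C * seq_norm e (trunc N (fun _ => 1))) by (field; lra); lra.
  + apply Rmult_le_compat_r; [now apply P|apply Rmax_r].
Qed.

(** * Subsequences of unconditional bases of mixed-norm spaces *)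

Section Subsequences.
Variables (e f : expo) (He : valid e) (Hf : valid f) (Hef : e <> f).

Let X := mix_mem e f.
Let nrm := mix_norm e f.
Let L := mix_lat_mat e f He Hf.

Variables (x : nat -> mat) (K m M : R).
Hypothesis (Hb : schauder_basis X nrm x) (HK : 1 <= K) (Hm : 0 < m).
Hypothesis (Hu : forall N a eps, signs eps ->
  nrm (lcomb N (fun k => eps k * a k) x) <= K * nrm (lcomb N a x)).
Hypothesis (Hx : forall n, m <= nrm (x n) <= M).

(* The entries outside both regions are finitely many, and [x_n^*(e_ij) e_ij^*(x_n)] tends to [0]
   with [n] for fixed [(i, j)]. *)
Lemma densities_sum (k t : nat) : exists n0, forall n, (n0 <= n)%nat ->
  1 / 2 <= density nrm x tail_columns k n + density nrm x (tail_rows k) t n.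
Proof.
assert (Xx := proj1 Hb).
assert (XU : forall i j, X (unit_mat i j)) by (intros; apply (lm_unit _ _ L)).
assert (lim : is_lim_seq (fun n => fsum t (fun i => fsum k (fun j =>
    M * Rabs (coef nrm x (unit_mat i j) n)))) 0).
{ assert (S : forall N (g : nat -> nat -> R), (forall i, is_lim_seq (fun n => g i n) 0) ->
     is_lim_seq (fun n => fsum N (fun i => g i n)) 0).
  { clear; intros N g H; induction N as [|N IH]; simpl; [apply is_lim_seq_const|].
    replace (Finite 0) with (Finite (0 + 0)) by (f_equal; ring); now apply is_lim_seq_plus'. }
  apply (S t (fun i n => _)); intros i; apply (S k (fun j n => _)); intros j.
  replace (Finite 0) with (Rbar_mult M 0) by (simpl; f_equal; ring).
  apply is_lim_seq_scal_l; apply -> is_lim_seq_abs_0.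
  now apply (coef_lim X nrm L x Hb m M Hm Hx). }
destruct (proj1 (lim0_spec _) lim (1 / 2)) as [n0 Hn0]; [lra|].
exists n0; intros n Hn; specialize (Hn0 n Hn).
set (F := msum t (fun i => msum k (fun j => mscal (x n i j) (unit_mat i j)))).
assert (XF : forall i, X (msum k (fun j => mscal (x n i j) (unit_mat i j))))
  by (intros; apply (X_msum X nrm L); intros; now apply (X_scal X nrm L)).
assert (E : x n = madd (madd (proj (tail_columns k) (x n)) (proj (tail_rows k t) (x n))) F).
{ extensionality i; extensionality j; unfold madd, proj, tail_columns, tail_rows, F, msum, mscal.
  cbn [fst snd].
  assert (Z : forall a b, (a, b) <> (i, j) -> x n a b * unit_mat a b i j = 0).
  { intros a b Hab; unfold unit_mat.
    destruct (Nat.eqb_spec i a), (Nat.eqb_spec j b); subst; simpl; try ring; now elim Hab. }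
  assert (U : unit_mat i j i j = 1) by (unfold unit_mat; now rewrite !Nat.eqb_refl).
  destruct (Nat.leb_spec k j), (Nat.ltb_spec j k); try lia.
  - rewrite Bool.andb_false_r, fsum_0; [ring|].
    intros a _; apply fsum_0; intros b Hbk; apply Z; intros Q; injection Q; lia.
  - rewrite Bool.andb_true_r; destruct (Nat.leb_spec t i).
    + rewrite fsum_0; [ring|].
      intros a Ha; apply fsum_0; intros b Hbk; apply Z; intros Q; injection Q; lia.
    + rewrite (fsum_single t i), (fsum_single k j), U; trivial; [ring| |].
      * intros b _ Hbj; apply Z; intros Q; injection Q; lia.
      * intros a _ Ha; apply fsum_0; intros b _; apply Z; intros Q; injection Q; lia. }
assert (one := coef_basis X nrm L x Hb n n); rewrite Nat.eqb_refl in one.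
rewrite E in one.
assert (XP : forall J, X (proj J (x n))) by (intros; now apply (X_proj X nrm L)).
rewrite (coef_madd X nrm L x Hb) in one;
  [|now apply (X_add X nrm L)|now apply (X_msum X nrm L)].
rewrite (coef_madd X nrm L x Hb) in one by trivial.
assert (small : Rabs (coef nrm x F n) < 1 / 2).
{ eapply Rle_lt_trans; [|eapply Rle_lt_trans; [apply Rle_abs|exact Hn0]].
  unfold F; rewrite (coef_msum X nrm L x Hb) by trivial.
  eapply Rle_trans; [apply fsum_abs|]; apply fsum_le; intros i _.
  rewrite (coef_msum X nrm L x Hb) by (intros; now apply (X_scal X nrm L)).
  eapply Rle_trans; [apply fsum_abs|]; apply fsum_le; intros j _.
  rewrite (coef_mscal X nrm L x Hb), Rabs_mult by trivial.
  apply Rmult_le_compat_r; [apply Rabs_pos|].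
  eapply Rle_trans; [apply (lm_coord _ _ L), Xx|apply Hx]. }
unfold density; apply Rabs_def2 in small; lra.
Qed.

(* If no subsequence lives on ever later columns, then the basis lives on finitely many columns,
   and the outer basis [e_(0,i)] would embed into them. *)
Lemma outer_subsequence : has_subseq_equiv nrm x f.
Proof.
destruct (classic (forall t n0, exists n, (n0 <= n)%nat /\
    1 / 4 <= Rabs (density nrm x tail_columns t n))) as [H|H].
- destruct (dense_subsequence X nrm L x Hb K m M HK Hm Hu Hx tail_columns
    (region_columns e f He Hf) H) as (phi & v & H1 & H2 & H3).
  exists phi; split; trivial; apply (equivalent_unit_basis nrm _ v); trivial.
  now apply (column_blocks_equiv e f He Hf).
- exfalso; apply not_all_ex_not in H; destruct H as [k H].
  apply not_all_ex_not in H; destruct H as [n0 H].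
  assert (small : forall n, (n0 <= n)%nat -> Rabs (density nrm x tail_columns k n) < 1 / 4).
  { intros n Hn; apply Rnot_le_lt; intros G; apply H; now exists n. }
  destruct (codense_subsequence X nrm L x Hb K m M HK Hm Hu Hx (tail_rows k)
    (fun _ => 0%nat) (fun i => i)) as (phi & v & H1 & H2 & H3).
  + apply (region_rows e f He Hf).
  + intros t; destruct (densities_sum k t) as [n1 Hn1]; exists (Nat.max n0 n1); intros n Hn.
    specialize (small n ltac:(lia)); specialize (Hn1 n ltac:(lia)).
    apply Rabs_def2 in small; lra.
  + easy.
  + apply (region_entries_lim e f He Hf tail_columns); [apply (region_columns e f He Hf)|].
    intros t i Hti; now apply Nat.leb_le.
  + apply Hef; apply (equiv_unit_basis_unique nrm (fun n => unit_mat 0 (phi n))); trivial.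
    * apply (equivalent_unit_basis nrm _ v); trivial; now apply (row_blocks_equiv e f He Hf k).
    * apply (column_blocks_equiv e f He Hf); now apply unit_column_blocks.
Qed.

(** If no [k] gives a subsequence living on the rows of the first [k] columns, then for every [k]
    the row density falls below [1/4] for some [t] and all large [n], so every column density is
    eventually at least [1/4]. The unit matrices at [(i, 0)], which span the inner space, would then
    embed into disjoint column shells. *)
Lemma inner_subsequence : has_subseq_equiv nrm x e.
Proof.
destruct (classic (exists k, forall t n0, exists n, (n0 <= n)%nat /\
    1 / 4 <= Rabs (density nrm x (tail_rows k) t n))) as [[k H]|H].
- destruct (dense_subsequence X nrm L x Hb K m M HK Hm Hu Hx (tail_rows k)
    (region_rows e f He Hf k) H) as (phi & v & H1 & H2 & H3).
  exists phi; split; trivial; apply (equivalent_unit_basis nrm _ v); trivial.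
  now apply (row_blocks_equiv e f He Hf k).
- exfalso.
  destruct (codense_subsequence X nrm L x Hb K m M HK Hm Hu Hx tail_columns
    (fun i => i) (fun _ => 0%nat)) as (phi & v & H1 & H2 & H3).
  + apply (region_columns e f He Hf).
  + intros k; apply not_ex_all_not with (n := k) in H.
    apply not_all_ex_not in H; destruct H as [t H].
    apply not_all_ex_not in H; destruct H as [n0 H].
    destruct (densities_sum k t) as [n1 Hn1]; exists (Nat.max n0 n1); intros n Hn.
    specialize (Hn1 n ltac:(lia)).
    assert (small : Rabs (density nrm x (tail_rows k) t n) < 1 / 4).
    { apply Rnot_le_lt; intros G; apply H; exists n; split; [lia|trivial]. }
    apply Rabs_def2 in small; lra.
  + easy.
  + apply (region_entries_lim e f He Hf (tail_rows 1)); [apply (region_rows e f He Hf)|].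
    intros t i Hti; unfold tail_rows; simpl; rewrite Bool.andb_true_r; now apply Nat.leb_le.
  + apply Hef; symmetry.
    apply (equiv_unit_basis_unique nrm (fun n => unit_mat (phi n) 0)); trivial.
    * apply (equivalent_unit_basis nrm _ v); trivial; now apply (column_blocks_equiv e f He Hf).
    * apply (row_blocks_equiv e f He Hf 1); now apply unit_row_blocks.
Qed.
End Subsequences.

Lemma unconditional_constant (X : mat -> Prop) (nrm : mat -> R) (x : nat -> mat) :
  lat_mat X nrm -> (forall n, X (x n)) -> unconditional nrm x ->
  exists K, 1 <= K /\ forall N a eps, signs eps ->
    nrm (lcomb N (fun k => eps k * a k) x) <= K * nrm (lcomb N a x).
Proof.
intros L Xx [C HC]; exists (Rmax C 1); split; [apply Rmax_r|]; intros N a eps Heps.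
eapply Rle_trans; [now apply HC|]; apply Rmult_le_compat_r; [|apply Rmax_l].
now apply (nrm_nonneg X nrm L), (X_lcomb X nrm L).
Qed.

Lemma subsequences (e f : expo) (x : nat -> mat) : valid e -> valid f -> e <> f ->
  normalized_unconditional_basis (mix_mem e f) (mix_norm e f) x ->
  has_subseq_equiv (mix_norm e f) x e /\ has_subseq_equiv (mix_norm e f) x f.
Proof.
intros He Hf Hef (Hb & Hu & Hn).
destruct (unconditional_constant _ _ x (mix_lat_mat e f He Hf) (proj1 Hb) Hu) as (K & HK & Hs).
assert (Hx : forall n, 1 <= mix_norm e f (x n) <= 1) by (intros n; rewrite Hn; lra).
split; [apply (inner_subsequence e f He Hf Hef x K 1 1)|
  apply (outer_subsequence e f He Hf Hef x K 1 1)]; trivial; lra.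
Qed.

(** * Greedy bases *)

Lemma lcomb_list_app (l1 l2 : list nat) (a : nat -> R) (x : nat -> mat) (i j : nat) :
  lcomb_list (l1 ++ l2) a x i j = lcomb_list l1 a x i j + lcomb_list l2 a x i j.
Proof.
unfold lcomb_list; induction l1 as [|k l1 IH]; simpl; [ring|rewrite IH; ring].
Qed.

Lemma lcomb_list_run (x : nat -> mat) (r : nat -> nat) (s N : nat) :
  lcomb_list (map r (seq s N)) (fun _ => 1) x =
  lcomb (s + N) (fun k => if Nat.leb s k then 1 else 0) (fun n => x (r n)).
Proof.
extensionality i; extensionality j; unfold lcomb.
induction N as [|N IH].
- rewrite Nat.add_0_r, fsum_0; trivial.
  intros k Hk; destruct (Nat.leb_spec s k); [lia|ring].
- rewrite seq_S, map_app, lcomb_list_app, IH, Nat.add_succ_r; unfold lcomb_list; simpl.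
  destruct (Nat.leb_spec s (s + N)); [ring|lia].
Qed.

Lemma lcomb_list_single (x : nat -> mat) (i : nat) : lcomb_list (i :: nil) (fun _ => 1) x = x i.
Proof. extensionality p; extensionality q; unfold lcomb_list; simpl; ring. Qed.

Lemma NoDup_run (r : nat -> nat) (s N : nat) : (forall n, (r n < r (S n))%nat) ->
  NoDup (map r (seq s N)).
Proof.
intros Hr; apply NoDup_map_NoDup_ForallPairs; [|apply seq_NoDup].
intros i j _ _ E; assert (H := increasing_lt r Hr).
destruct (Nat.lt_trichotomy i j) as [l|[l|l]]; trivial; specialize (H _ _ l); lia.
Qed.

Section Greedy.
Variables (X : mat -> Prop) (nrm : mat -> R) (L : lat_mat X nrm) (x : nat -> mat).
Hypothesis (Hb : schauder_basis X nrm x).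
Variable C : R.
Hypothesis HC : forall (y : mat) (a : nat -> R) (n : nat) (A : list nat),
  X y -> expands nrm x y a -> NoDup A -> length A = n ->
  (forall i j, In i A -> ~ In j A -> Rabs (a j) <= Rabs (a i)) ->
  forall (B : list nat) (b : nat -> R), NoDup B -> length B = n ->
    nrm (msub y (lcomb_list A a x)) <= C * nrm (msub y (lcomb_list B b x)).

Let Xx : forall n, X (x n) := proj1 Hb.

Lemma expands_lcomb (N : nat) (a : nat -> R) : (forall k, (N <= k)%nat -> a k = 0) ->
  expands nrm x (lcomb N a x) a.
Proof.
intros Ha; apply (is_lim_seq_ext_loc (fun _ => 0)); [|apply is_lim_seq_const].
exists N; intros n Hn; rewrite (lcomb_extend N n _ x Hn) by trivial.
symmetry; etransitivity; [|apply (nrm_0 X nrm L)]; f_equal.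
extensionality i; extensionality j; unfold msub; ring.
Qed.

Lemma lcomb_list_filter (N : nat) (P : nat -> bool) (a : nat -> R) :
  lcomb_list (filter P (seq 0 N)) a x = lcomb N (fun k => if P k then a k else 0) x.
Proof.
extensionality i; extensionality j; unfold lcomb.
induction N as [|N IH]; [reflexivity|].
rewrite seq_S, filter_app, lcomb_list_app, IH; simpl.
destruct (P N); unfold lcomb_list; simpl; ring.
Qed.

Lemma msub_lcomb (N : nat) (a b : nat -> R) :
  msub (lcomb N a x) (lcomb N b x) = lcomb N (fun k => a k - b k) x.
Proof.
extensionality i; extensionality j; unfold msub, lcomb.
rewrite <- (Rmult_1_l (fsum N (fun k => b k * _))); unfold Rminus.
rewrite <- Ropp_mult_distr_l_reverse, <- fsum_scal, <- fsum_plus.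
apply fsum_ext; intros; ring.
Qed.

(* Adding a large constant to the coefficients to be removed makes them a greedy set. *)
Lemma greedy_suppression (N : nat) (a : nat -> R) (P : nat -> bool) :
  nrm (lcomb N (fun k => if P k then 0 else a k) x) <= C * nrm (lcomb N a x).
Proof.
set (t := 2 * fsum N (fun k => Rabs (a k))).
assert (Ha : forall k, (k < N)%nat -> 2 * Rabs (a k) <= t).
{ intros k Hk; unfold t; apply Rmult_le_compat_l; [lra|].
  apply Rle_trans with (fsum N (fun l => if Nat.eqb l k then Rabs (a l) else 0)).
  - rewrite (fsum_single N k); [rewrite Nat.eqb_refl; lra|trivial|].
    intros l _ Hl; now destruct (Nat.eqb_spec l k).
  - apply fsum_le; intros l _; destruct (Nat.eqb l k); [lra|apply Rabs_pos]. }
set (b := fun k => if Nat.ltb k N then if P k then a k + t else a k else 0).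
assert (G := HC (lcomb N b x) b _ (filter P (seq 0 N)) (X_lcomb X nrm L N b x Xx)
  (expands_lcomb N b ltac:(intros k Hk; unfold b; destruct (Nat.ltb_spec k N); [lia|reflexivity]))
  (NoDup_filter _ (seq_NoDup N 0)) eq_refl).
assert (greedy_set : forall i j, In i (filter P (seq 0 N)) -> ~ In j (filter P (seq 0 N)) ->
  Rabs (b j) <= Rabs (b i)).
{ intros i j Hi Hj; rewrite filter_In, in_seq in Hi, Hj; unfold b.
  destruct Hi as [Hi Pi]; rewrite Pi.
  destruct (Nat.ltb_spec i N) as [_|]; [|lia].
  assert (Hi' := Ha i ltac:(lia)); assert (Pa := Rabs_pos (a i)).
  destruct (Nat.ltb_spec j N) as [HjN|]; [|rewrite Rabs_R0; apply Rabs_pos].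
  destruct (P j) eqn:Pj; [elim Hj; split; [lia|trivial]|].
  assert (Hj' := Ha j HjN).
  eapply Rle_trans; [|apply Rle_abs].
  assert (Q := Rle_abs (- a i)); rewrite Rabs_Ropp in Q; lra. }
specialize (G greedy_set (filter P (seq 0 N)) (fun _ => t)
  (NoDup_filter _ (seq_NoDup N 0)) eq_refl).
rewrite !lcomb_list_filter, !msub_lcomb in G.
rewrite (lcomb_ext N _ (fun k => if P k then 0 else a k)) in G.
- rewrite (lcomb_ext N (fun k => b k - _) a) in G; trivial.
  intros k Hk; unfold b; destruct (Nat.ltb_spec k N); [|lia]; destruct (P k); ring.
- intros k Hk; unfold b; destruct (Nat.ltb_spec k N); [|lia]; destruct (P k); ring.
Qed.

(** A change of signs is the difference of two suppressions: the part with sign [1] minus the part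
    with sign [-1]. *)
Lemma greedy_unconditional : unconditional nrm x.
Proof.
exists (C + C); intros N a eps Heps.
set (P := fun k => if Req_EM_T (eps k) 1 then true else false).
assert (H1 := greedy_suppression N a P).
assert (H2 := greedy_suppression N a (fun k => negb (P k))).
eapply Rle_trans; [|rewrite Rmult_plus_distr_r; apply Rplus_le_compat; [exact H2|exact H1]].
eapply Rle_trans; [|apply (nrm_sub X nrm L); now apply (X_lcomb X nrm L)].
right; rewrite msub_lcomb; f_equal; apply lcomb_ext; intros k _; unfold P.
destruct (Req_EM_T (eps k) 1) as [E|E]; [rewrite E; simpl; ring|].
destruct (Heps k) as [|F]; [easy|]; rewrite F; simpl; ring.
Qed.

Definition indicator (A : list nat) (k : nat) : R := if in_dec Nat.eq_dec k A then 1 else 0.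

(** Apply greediness to the sum over [A] and [B] together: all its nonzero coefficients equal [1],
    so [A] is a greedy set, and removing [B] instead is an admissible competitor. *)
Lemma greedy_democratic (A B : list nat) : NoDup A -> NoDup B -> length A = length B ->
  (forall k, In k A -> ~ In k B) ->
  nrm (lcomb_list B (fun _ => 1) x) <= C * nrm (lcomb_list A (fun _ => 1) x).
Proof.
intros HA HB Hlen Hdisj.
assert (bound : forall l : list nat, exists N, forall k, In k l -> (k < N)%nat).
{ induction l as [|k l [N HN]]; [exists 0%nat; easy|]; exists (S (Nat.max k N)).
  intros k' [<-|H]; [lia|]; specialize (HN k' H); lia. }
destruct (bound (A ++ B)) as [N HN].
assert (lin : forall D, NoDup D -> (forall k, In k D -> (k < N)%nat) ->
   lcomb_list D (fun _ => 1) x = lcomb N (indicator D) x).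
{ intros D HD HDN; extensionality i; extensionality j; unfold lcomb_list, lcomb.
  induction HD as [|k D Hk HD IH]; simpl.
  - rewrite fsum_0; trivial; intros; unfold indicator; simpl; ring.
  - rewrite IH by (intros; apply HDN; now right).
    transitivity (fsum N (fun l => (if Nat.eqb l k then x l i j else 0) + indicator D l * x l i j)).
    + rewrite fsum_plus, (fsum_single N k (fun l => if Nat.eqb l k then _ else 0)); [rewrite Nat.eqb_refl; ring|apply HDN; now left|].
      intros l _ Hl; now destruct (Nat.eqb_spec l k).
    + apply fsum_ext; intros l _; unfold indicator.
      destruct (in_dec Nat.eq_dec l (k :: D)) as [h|h], (in_dec Nat.eq_dec l D) as [h'|h'],
        (Nat.eqb_spec l k) as [Hl|Hl]; simpl in h; subst; try ring; try easy;
        exfalso; intuition congruence. }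
assert (EA := lin A HA (fun k H => HN k (in_or_app _ _ _ (or_introl H)))).
assert (EB := lin B HB (fun k H => HN k (in_or_app _ _ _ (or_intror H)))).
set (b := fun k => indicator A k + indicator B k).
assert (b01 : forall k, Rabs (b k) <= 1 /\ (In k A -> b k = 1)).
{ intros k; unfold b, indicator; specialize (Hdisj k).
  destruct (in_dec Nat.eq_dec k A), (in_dec Nat.eq_dec k B);
    rewrite ?Rplus_0_l, ?Rplus_0_r, ?Rabs_R1, ?Rabs_R0; try tauto; split; try lra; tauto. }
assert (b0 : forall k, (N <= k)%nat -> b k = 0).
{ intros k Hk; unfold b, indicator.
  destruct (in_dec Nat.eq_dec k A) as [h|h];
    [specialize (HN k (in_or_app _ _ _ (or_introl h))); lia|].
  destruct (in_dec Nat.eq_dec k B) as [h'|h'];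
    [specialize (HN k (in_or_app _ _ _ (or_intror h'))); lia|ring]. }
assert (G := HC (lcomb N b x) b (length A) A (X_lcomb X nrm L N b x Xx) (expands_lcomb N b b0)
  HA eq_refl).
assert (gr : forall i j, In i A -> ~ In j A -> Rabs (b j) <= Rabs (b i)).
{ intros i j Hi _; rewrite (proj2 (b01 i) Hi), Rabs_R1; apply b01. }
specialize (G gr B (fun _ => 1) HB (eq_sym Hlen)).
assert (EbA : lcomb_list A b x = lcomb_list A (fun _ => 1) x).
{ extensionality i; extensionality j; unfold lcomb_list.
  assert (W : forall D, incl D A -> fold_right (fun k s => b k * x k i j + s) 0 D =
     fold_right (fun k s => 1 * x k i j + s) 0 D).
  { induction D as [|k D IH]; intros HD; simpl; trivial.
    rewrite IH, (proj2 (b01 k)); trivial; [apply HD; now left|].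
    intros l Hl; apply HD; now right. }
  apply W, incl_refl. }
rewrite EbA, EA, EB, !msub_lcomb in G; rewrite EA, EB.
rewrite (lcomb_ext N (fun k => b k - indicator A k) (indicator B)),
  (lcomb_ext N (fun k => b k - indicator B k) (indicator A)) in G by (intros; unfold b; ring).
exact G.
Qed.

(** Democracy for singletons compares any two basis vectors. Their norms are not zero: with
    [x 0 = 0] the zero vector would have two expansions. The maximum [D] with [1] covers equal
    indices. *)
Lemma greedy_seminormalized : exists m M, 0 < m /\ forall n, m <= nrm (x n) <= M.
Proof.
assert (cmp : forall i j, i <> j -> nrm (x j) <= C * nrm (x i)).
{ intros i j Hij; rewrite <- (lcomb_list_single x i), <- (lcomb_list_single x j).
  apply greedy_democratic; trivial.
  - constructor; [easy|constructor].
  - constructor; [easy|constructor].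
  - intros k [<-|[]] [E|[]]; congruence. }
assert (pos : 0 < nrm (x 0%nat)).
{ destruct (nrm_nonneg X nrm L (x 0%nat) (Xx 0%nat)) as [|E]; trivial; exfalso.
  assert (Z : forall p q, x 0%nat p q = 0).
  { intros p q; assert (H := lm_coord _ _ L (x 0%nat) p q (Xx 0%nat)); rewrite <- E in H.
    destruct (Req_dec (x 0%nat p q) 0) as [|n]; trivial; apply Rabs_pos_lt in n; lra. }
  assert (E1 : expands nrm x (lcomb 1 (fun _ => 0) x) (fun _ => 0)) by now apply expands_lcomb.
  assert (E2 : expands nrm x (lcomb 1 (fun _ => 0) x) (fun k => if Nat.eqb k 0 then 1 else 0)).
  { replace (lcomb 1 (fun _ => 0) x) with (lcomb 1 (fun k => if Nat.eqb k 0 then 1 else 0) x).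
    - apply expands_lcomb; intros k Hk; destruct (Nat.eqb_spec k 0); [lia|reflexivity].
    - extensionality p; extensionality q; unfold lcomb; simpl; rewrite Z; ring. }
  destruct (proj2 Hb _ (X_lcomb X nrm L 1 (fun _ => 0) x Xx)) as [c [_ Hc]].
  assert (H1 := Hc _ E1 0%nat); assert (H2 := Hc _ E2 0%nat); simpl in H2; lra. }
set (D := Rmax C 1).
assert (D1 : 1 <= D) by apply Rmax_r.
assert (cmp' : forall i j, nrm (x j) <= D * nrm (x i)).
{ intros i j; assert (P := nrm_nonneg X nrm L (x i) (Xx i)).
  destruct (Nat.eq_dec i j) as [->|Hij]; [nra|].
  eapply Rle_trans; [exact (cmp i j Hij)|]; apply Rmult_le_compat_r; [trivial|apply Rmax_l]. }
exists (nrm (x 0%nat) / D), (D * nrm (x 0%nat)); split; [apply Rdiv_lt_0_compat; lra|].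
intros n; split; [|apply cmp'].
apply Rmult_le_reg_l with D; [lra|].
replace (D * (nrm (x 0%nat) / D)) with (nrm (x 0%nat)) by (field; lra); apply cmp'.
Qed.
End Greedy.

(** Democracy compares [N] terms of the subsequence for the inner space with [N] terms of the one
    for the outer space, which makes the two fundamental functions comparable. A greedy basis is
    only seminormalized, which is why the subsequences were found under the bounds [m] and [M]. *)
Lemma not_greedy (e f : expo) : valid e -> valid f -> e <> f ->
  ~ exists x, greedy_basis (mix_mem e f) (mix_norm e f) x.
Proof.
intros He Hf Hef (x & Hb & C & HC).
set (X := mix_mem e f) in *; set (nrm := mix_norm e f) in *.
assert (L : lat_mat X nrm) by exact (mix_lat_mat e f He Hf).
assert (Xx := proj1 Hb).
destruct (unconditional_constant X nrm x L Xx (greedy_unconditional X nrm L x Hb C HC))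
  as (K & HK & Hu).
destruct (greedy_seminormalized X nrm L x Hb C HC) as (m & M & Hm & Hx).
destruct (inner_subsequence e f He Hf Hef x K m M Hb HK Hm Hu Hx)
  as (phi & Hphi & c & D & Hc & HD).
destruct (outer_subsequence e f He Hf Hef x K m M Hb HK Hm Hu Hx)
  as (psi & Hpsi & d & E & Hd & HE).
fold nrm in HD, HE.
assert (cmp : forall N, seq_norm e (trunc N (fun _ => 1)) <=
     Rmax (C * E / c) (C * D / d) * seq_norm f (trunc N (fun _ => 1)) /\
   seq_norm f (trunc N (fun _ => 1)) <=
     Rmax (C * E / c) (C * D / d) * seq_norm e (trunc N (fun _ => 1))).
(* As [psi j >= j], starting [psi] at [s] puts its indices beyond all [phi i] with [i < N], so the
   two index sets are disjoint. *)
{ intros N; set (s := S (phi N)).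
  set (A := map phi (seq 0 N)); set (B := map psi (seq s N)).
  assert (len : length A = length B) by (unfold A, B; now rewrite !length_map, !length_seq).
  assert (disj : forall k, In k A -> ~ In k B).
  { intros k HA HB; apply in_map_iff in HA, HB.
    destruct HA as (i & <- & Hi), HB as (j & E0 & Hj); apply in_seq in Hi, Hj.
    assert (H1 := increasing_lt phi Hphi i N ltac:(lia)).
    assert (H2 : forall n, (n <= psi n)%nat).
    { induction n as [|n IH]; [lia|specialize (Hpsi n); lia]. }
    specialize (H2 j); unfold s in Hj; lia. }
  assert (G1 := greedy_democratic X nrm L x Hb C HC A B (NoDup_run _ _ _ Hphi)
    (NoDup_run _ _ _ Hpsi) len disj).
  assert (G2 := greedy_democratic X nrm L x Hb C HC B A (NoDup_run _ _ _ Hpsi)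
    (NoDup_run _ _ _ Hphi) (eq_sym len) (fun k h h' => disj k h' h)).
  unfold A, B in G1, G2; rewrite !lcomb_list_run in G1, G2.
  destruct (HD (0 + N)%nat (fun k => if Nat.leb 0 k then 1 else 0)) as [D1 D2].
  destruct (HE (s + N)%nat (fun k => if Nat.leb s k then 1 else 0)) as [F1 F2].
  rewrite (ls_interval _ _ (valid_lat_seq e He)) in D1, D2.
  rewrite (ls_interval _ _ (valid_lat_seq f Hf)) in F1, F2.
  set (a := nrm (lcomb (0 + N) _ _)) in *; set (b := nrm (lcomb (s + N) _ _)) in *.
  assert (pos : forall g, valid g -> 0 <= seq_norm g (trunc N (fun _ => 1))).
  { intros g Hg; apply (ls_nonneg _ _ (valid_lat_seq g Hg)), (mem_trunc _ _ (valid_lat_seq g Hg)). }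
  assert (pe := pos e He); assert (pf := pos f Hf).
  set (u := seq_norm e _) in *; set (w := seq_norm f _) in *.
  (* A negative [C] would bound the positive norm of [x 1] by a negative number. *)
  assert (C0 : 0 <= C).
  { assert (one := greedy_democratic X nrm L x Hb C HC (0 :: nil)%nat (1 :: nil)%nat
      ltac:(constructor; [easy|constructor]) ltac:(constructor; [easy|constructor]) eq_refl
      ltac:(intros k [<-|[]] [E0|[]]; lia)).
    rewrite !lcomb_list_single in one; assert (x0 := Hx 0%nat); assert (x1 := Hx 1%nat).
    apply Rnot_lt_le; intros Cn; nra. }
  assert (H1 : c * u <= C * (E * w)).
  { eapply Rle_trans; [exact D1|]; eapply Rle_trans; [exact G2|].
    now apply Rmult_le_compat_l. }
  assert (H2 : d * w <= C * (D * u)).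
  { eapply Rle_trans; [exact F1|]; eapply Rle_trans; [exact G1|].
    now apply Rmult_le_compat_l. }
  split.
  - apply Rle_trans with (C * E / c * w).
    + apply Rmult_le_reg_l with c; [lra|].
      replace (c * (C * E / c * w)) with (C * (E * w)) by (field; lra); trivial.
    + apply (Rmult_le_compat_r w); [trivial|apply Rmax_l].
  - apply Rle_trans with (C * D / d * u).
    + apply Rmult_le_reg_l with d; [lra|].
      replace (d * (C * D / d * u)) with (C * (D * u)) by (field; lra); trivial.
    + apply (Rmult_le_compat_r u); [trivial|apply Rmax_r]. }
apply (norms_not_equivalent e f _ He Hf Hef (fun N => proj1 (cmp N)) (fun N => proj2 (cmp N))).
Qed.

Theorem theorem1 :
  (forall p q : R, 1 <= p -> 1 <= q -> p <> q ->
    forall x : nat -> mat,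
      normalized_unconditional_basis (mix_mem (Fin p) (Fin q)) (mix_norm (Fin p) (Fin q)) x ->
      has_subseq_equiv (mix_norm (Fin p) (Fin q)) x (Fin p) /\
      has_subseq_equiv (mix_norm (Fin p) (Fin q)) x (Fin q)) /\
  (forall p : R, 1 <= p ->
    forall x : nat -> mat,
      normalized_unconditional_basis (mix_mem (Fin p) Czero) (mix_norm (Fin p) Czero) x ->
      has_subseq_equiv (mix_norm (Fin p) Czero) x (Fin p) /\
      has_subseq_equiv (mix_norm (Fin p) Czero) x Czero) /\
  (forall q : R, 1 <= q ->
    forall x : nat -> mat,
      normalized_unconditional_basis (mix_mem Czero (Fin q)) (mix_norm Czero (Fin q)) x ->
      has_subseq_equiv (mix_norm Czero (Fin q)) x Czero /\
      has_subseq_equiv (mix_norm Czero (Fin q)) x (Fin q)) /\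
  (forall p q : R, 1 <= p -> 1 <= q -> p <> q ->
    ~ exists x : nat -> mat,
        greedy_basis (mix_mem (Fin p) (Fin q)) (mix_norm (Fin p) (Fin q)) x) /\
  (forall p : R, 1 <= p ->
    ~ exists x : nat -> mat,
        greedy_basis (mix_mem (Fin p) Czero) (mix_norm (Fin p) Czero) x) /\
  (forall q : R, 1 <= q ->
    ~ exists x : nat -> mat,
        greedy_basis (mix_mem Czero (Fin q)) (mix_norm Czero (Fin q)) x).
Proof.
assert (pq : forall p q, p <> q -> Fin p <> Fin q) by (intros p q H E; now injection E).
repeat apply conj.
- intros p q Hp Hq Hpq x Hx; apply subsequences; auto.
- intros p Hp x Hx; apply subsequences; [exact Hp|exact I|discriminate|exact Hx].
- intros q Hq x Hx; apply subsequences; [exact I|exact Hq|discriminate|exact Hx].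
- intros p q Hp Hq Hpq; apply not_greedy; auto.
- intros p Hp; apply not_greedy; [exact Hp|exact I|discriminate].
- intros q Hq; apply not_greedy; [exact I|exact Hq|discriminate].
Qed.
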